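(* Let $k\ge 2$ and $\alpha \ge 0$ be integers and let $G=(V,E)$ be a $(k,\alpha)$-Helly graph with $n$ vertices and $m$ edges. There is a randomized algorithm that, given $G$ and $k$, with high probability computes in $\tilde{\mathcal O}(m\sqrt{kn})$ time an additive $+\alpha$-approximation of the radius $rad(G) = \min_{v\in V}\max_{u\in V} dist(u,v)$, namely an integer $R$ with $R \le rad(G) \le R + \alpha$.
   Context: For a graph $G=(V,E)$, $dist(u,v)$ is the number of edges of a shortest $uv$-path, and the ball of center $v$ and radius $r\ge 0$ is $N^r[v] = \{u \in V \mid dist(u,v)\le r\}$. A family of sets is $k$-wise intersecting if every subfamily of at most $k$ of its members has a nonempty common intersection. A graph is $(k,\alpha)$-Helly if for every $k$-wise intersecting family of balls $N^{r_1}[v_1],\ldots,N^{r_s}[v_s]$ ($s\ge 2$ arbitrary) there exists a vertex $x$ with $dist(x,v_i)\le r_i+\alpha$ for all $1\le i\le s$. ''With high probability'' means with probability at least $1 - 1/n^{c'}$ for some constant $c'>0$; $\tilde{\mathcal O}(\cdot)$ hides polylogarithmic factors in $n$. *)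

(* Defs.v *)
From mathcomp Require Import all_boot all_order all_algebra.
From mathcomp Require Import boolp reals exp.
Set Implicit Arguments.
Unset Strict Implicit.
Unset Printing Implicit Defensive.

Section Graph.
Variables (V : finType) (e : rel V).

Definition simple_graph : Prop := symmetric e /\ irreflexive e.

Definition connected_graph : Prop := forall u v, connect e u v.

Definition edges : {set {set V}} :=
  [set E : {set V} | [exists u, exists v, e u v && (E == [set u; v])]].

Definition has_path (u v : V) (d : nat) : bool :=
  [exists p : d.-tuple V, [&& path e u p, uniq (u :: p) & last u p == v]].

(* [find] returns #|V|, which exceeds every finite distance, when there is no
   path from u to v. *)
Definition dist (u v : V) : nat := find (has_path u v) (iota 0 #|V|).

Definition ball (v : V) (r : nat) : {set V} := [set u | dist u v <= r].

(* The neutral element #|V| of the minimum plays no role when the graph is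
   nonempty and connected, since all eccentricities are then below #|V|. *)
Definition radius : nat := \big[minn/#|V|]_(v : V) \max_(u : V) dist u v.

Definition kwise_intersecting (k : nat) (I : finType) (F : I -> {set V}) : Prop :=
  forall J : {set I}, #|J| <= k -> \bigcap_(i in J) F i != set0.

Definition helly (k alpha : nat) : Prop :=
  forall (s : nat) (v : 'I_s -> V) (r : 'I_s -> nat), 2 <= s ->
    kwise_intersecting k (fun i => ball (v i) (r i)) ->
    exists x, forall i, dist x (v i) <= r i + alpha.

End Graph.

(* Random access machine with coin tosses, under the logarithmic cost measure.
   Programs are structured (sequence, conditional, loop) instead of using
   jumps, which changes running times by constant factors only. The machine
   has a memory of natural numbers with indirect addressing, besides the
   variables that occur in the (fixed) program. *)
Inductive binop := Add | Sub | Mul | Div.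

Inductive expr :=
  | Const of nat
  | Var of nat
  | Fetch of expr
  | Bin of binop & expr & expr.

Inductive cmd :=
  | Skip
  | Assign of nat & expr
  | Store of expr & expr (* address, value *)
  | Toss of nat
  | Seq of cmd & cmd
  | If of expr & cmd & cmd
  | While of expr & cmd.

Record state := State { vars : nat -> nat; mem : nat -> nat }.

Definition update (f : nat -> nat) (x a : nat) : nat -> nat :=
  fun y => if y == x then a else f y.

Definition set_var (s : state) (x a : nat) := State (update (vars s) x a) (mem s).
Definition set_mem (s : state) (x a : nat) := State (vars s) (update (mem s) x a).

Definition binop_eval (o : binop) : nat -> nat -> nat :=
  match o with Add => addn | Sub => subn | Mul => muln | Div => divn end.

Fixpoint eval (s : state) (a : expr) : nat :=
  match a with
  | Const c => c
  | Var x => vars s x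
  | Fetch b => mem s (eval s b)
  | Bin o b c => binop_eval o (eval s b) (eval s c)
  end.

(* The binary length, with bit_length 0 = 1. *)
Definition bit_length (a : nat) : nat := (trunc_log 2 a).+1.

(* Every node is charged the length of its value; thus an operation pays for
   its operands and its result, and a memory access for the address and the
   contents. *)
Fixpoint cost (s : state) (a : expr) : nat :=
  bit_length (eval s a) +
  match a with
  | Const _ | Var _ => 0
  | Fetch b => cost s b
  | Bin _ b c => cost s b + cost s c
  end.

(* [exec c s w s' w' t]: started in state s with w the outcomes of the coming
   coin tosses, c halts in state s' after t units of time, and w' are the
   outcomes it has not consumed. Conditions test for being nonzero. *)
Inductive exec : cmd -> state -> seq bool -> state -> seq bool -> nat -> Prop :=
  | ExecSkip s w : exec Skip s w s w 1
  | ExecAssign x a s w :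
      exec (Assign x a) s w (set_var s x (eval s a)) w (cost s a)
  | ExecStore a b s w :
      exec (Store a b) s w (set_mem s (eval s a) (eval s b)) w
           (cost s a + cost s b)
  | ExecToss x s (b : bool) w : exec (Toss x) s (b :: w) (set_var s x b) w 1
  | ExecSeq c1 c2 s1 w1 t1 s2 w2 t2 s3 w3 :
      exec c1 s1 w1 s2 w2 t1 -> exec c2 s2 w2 s3 w3 t2 ->
      exec (Seq c1 c2) s1 w1 s3 w3 (t1 + t2)
  | ExecIf a c1 c2 s w s' w' t :
      exec (if eval s a != 0 then c1 else c2) s w s' w' t ->
      exec (If a c1 c2) s w s' w' (cost s a + t)
  | ExecWhileStop a c s w :
      eval s a = 0 -> exec (While a c) s w s w (cost s a)
  | ExecWhileLoop a c s1 w1 t1 s2 w2 t2 s3 w3 :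
      eval s1 a != 0 -> exec c s1 w1 s2 w2 t1 ->
      exec (While a c) s2 w2 s3 w3 t2 ->
      exec (While a c) s1 w1 s3 w3 (cost s1 a + t1 + t2).

(* The input occupies an initial segment of the memory; everything else is 0. *)
Definition init (input : seq nat) : state := State (fun=> 0) (nth 0 input).

(* The output is the final value of variable 0. *)
Definition halts_within (T : nat) (c : cmd) (input : seq nat)
    (Q : nat -> Prop) (w : seq bool) : Prop :=
  exists s' w' t,
    [/\ exec c (init input) w s' w' t, t <= T & Q (vars s' 0)].

(* Probability that c halts within time T with an output satisfying Q. A toss
   takes one unit of time, so only the first T coins matter. *)
Definition success_prob (R : realType) (T : nat) (c : cmd) (input : seq nat)
    (Q : nat -> Prop) : R :=
  (#|[set w : T.-tuple bool | `[< halts_within T c input Q w >]]|%:R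
     / (2 ^ T)%:R)%R.

(* adj lists the neighbours of each vertex, in arbitrary order. *)
Definition adjacency_lists (n : nat) (e : rel 'I_n) (adj : 'I_n -> seq 'I_n) :
    Prop :=
  forall u, uniq (adj u) /\ forall v, (v \in adj u) = e u v.

(* n and k, then for each i <= n the total length of the lists of the vertices
   less than i, then the concatenation of the lists. *)
Definition graph_input (n : nat) (adj : 'I_n -> seq 'I_n) (k : nat) : seq nat :=
  [:: n, k
    & [seq \sum_(u < n | u < i) size (adj u) | i <- iota 0 n.+1]
      ++ flatten [seq map val (adj u) | u <- enum 'I_n]].

(* Main.v *)
Require Import Defs.
From mathcomp Require Import all_boot all_order all_algebra.
From mathcomp Require Import boolp reals exp.
From mathcomp Require Import zify ring lra.
Set Implicit Arguments.
Unset Strict Implicit.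
Unset Printing Implicit Defensive.
Import Order.TTheory GRing.Theory Num.Theory.

(** The algorithm keeps a set U of sources and, for each vertex v, the largest
    distance E(v) from v to U, obtained by breadth-first searches. Initially U
    consists of about sqrt(kn) random vertices. A round takes a vertex x
    minimizing E, adds to U all vertices farther than E(x) from x, and updates
    E. The value min E never exceeds the radius. If no vertex was added, it
    equals the radius. If k vertices have no common point within distance
    r = min E, then each round adds to U one of them that was missing, as x is
    not within distance r of all of them; so after k rounds the balls of radius
    min E are k-wise intersecting and the Helly property bounds the radius by
    min E + alpha. Hence the output is always right and only the running time
    is random: with high probability the sample meets all sets of the form
    {v | dist(x, v) >= t} with more than q = 6 n ln n / sqrt(kn) elements, and
    then a round performs at most q + 1 searches. *)

(** * Distances and breadth-first search *)

(** The number of samples balances two costs. With s samples, a set of more than q vertices is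
    unlikely to be missed once q is about (n ln n)/s, and the run then makes about s + k q searches;
    s = sqrt(kn) equalizes both terms up to a logarithm. The candidates depend on the coins, so the
    sample must meet all large sets {v | dist(x, v) >= t} simultaneously: there are n^2 pairs (x,
    t), and each set may be missed with probability at most n^(-3) for a total of 1/n. A sample is a
    number spelled by L coins and reduced modulo n, where 2^L <= 2n; it need not be uniform, but it
    hits each vertex with probability at least 1/(2n). Hence the constant 6 = 2 * 3 in q. As costs
    are logarithmic, time is counted in units of the bit length of a bound M <= n^5 on all stored
    numbers. Only k escapes this bound; replacing it by min(k, n) costs O(log k), which sqrt(kn)
    absorbs, and loses nothing because k only limits the size of sets of vertices. Distances are
    stored plus one, so that 0 can mark unvisited vertices and blank memory encodes an empty set of
    sources. *)

Section Distance.
Variables (V : finType) (e : rel V).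
Hypotheses (e_sym : symmetric e) (e_conn : connected_graph e).

Lemma has_pathP u v d :
  reflect (exists p, [/\ path e u p, uniq (u :: p), last u p = v & size p = d])
          (has_path e u v d).
Proof.
apply: (iffP existsP) => [[p /and3P[pp up /eqP lp]]|[p [pp up lp sp]]].
  by exists p; split=> //; rewrite size_tuple.
by move/eqP: sp => sp; exists (Tuple sp); rewrite pp up /= lp eqxx.
Qed.

(** Paths with repetitions qualify: shortening to a simple path gives a length below [#|V|], hence
    one that [find] does inspect. *)
Lemma dist_le_path u p : path e u p -> dist e u (last u p) <= size p.
Proof.
move=> pp; case: (shortenP pp) => p' pp' up' /uniq_leq_size sp'.
have {sp'} : size p' <= size p by apply: sp'; case/andP: up'.
apply: leq_trans; rewrite leqNgt; apply/negP => lt.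
have lt2 : size p' < #|V|.
  by rewrite -[(size p').+1]/(size (last u [::] :: p')) -(card_uniqP up') max_card.
have := before_find 0 lt; rewrite nth_iota // add0n => nh.
suff: has_path e u (last u p') (size p') by rewrite nh.
by apply/has_pathP; exists p'.
Qed.

Lemma shortest_path u v :
  exists p, [/\ path e u p, last u p = v & size p = dist e u v].
Proof.
have /connectP[p pp ->] := e_conn u v.
case: (shortenP pp) => p' pp' up' _.
have lt2 : size p' < #|V|.
  by rewrite -[(size p').+1]/(size (last u [::] :: p')) -(card_uniqP up') max_card.
have hasp : has (has_path e u (last u p')) (iota 0 #|V|).
  apply/hasP; exists (size p'); first by rewrite mem_iota.
  by apply/has_pathP; exists p'.
have := nth_find 0 hasp; move: (hasp); rewrite has_find size_iota => lt.
rewrite nth_iota // add0n => /has_pathP[r [pr _ lr sr]].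
by exists r.
Qed.

Lemma dist_lt_card u v : dist e u v < #|V|.
Proof.
have [p [pp <- _]] := shortest_path u v.
case: (shortenP pp) => p' pp' up' _.
apply: leq_ltn_trans (dist_le_path pp') _.
by rewrite -[(size p').+1]/(size (last u [::] :: p')) -(card_uniqP up') max_card.
Qed.

Lemma dist_refl u : dist e u u = 0.
Proof. by apply/eqP; rewrite -leqn0 (@dist_le_path u [::]). Qed.

Lemma dist_sym u v : dist e u v = dist e v u.
Proof.
suff le u' v' : dist e u' v' <= dist e v' u' by apply/eqP; rewrite eqn_leq !le.
have [p [pp lp <-]] := shortest_path v' u'.
have := @dist_le_path u' (rev (belast v' p)).
rewrite size_rev size_belast -lp rev_path (eq_path (e' := e)); last first.
  by move=> x y; rewrite /= e_sym.
move=> /(_ pp); rewrite -/(last _ _).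
case: p lp {pp} => [|a p] lp //=.
by rewrite rev_cons last_rcons.
Qed.

Lemma dist_edge u v w : e v w -> dist e u w <= (dist e u v).+1.
Proof.
move=> evw; have [p [pp lp <-]] := shortest_path u v.
have := @dist_le_path u (rcons p w).
by rewrite rcons_path pp lp evw last_rcons size_rcons; apply.
Qed.

Lemma dist_pred u v : u != v -> exists2 w, e w v & (dist e u w).+1 = dist e u v.
Proof.
move=> neq; have [p [pp lp sp]] := shortest_path u v.
case/lastP: p pp lp sp => [|p w]; first by move=> _ /= uv; rewrite uv eqxx in neq.
rewrite rcons_path last_rcons size_rcons => /andP[pp ew] wv sp; subst w.
exists (last u p) => //; apply/eqP; rewrite eqn_leq dist_edge // -sp andbT.
by rewrite ltnS dist_le_path.
Qed.

End Distance.

Section BreadthFirst.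
Variables (n : nat) (e : rel 'I_n) (x0 src : 'I_n).
Hypotheses (e_sym : symmetric e) (e_conn : connected_graph e).

(* [q] is the queue together with the part already popped, [h] its head. *)
Record bfs_inv (q : seq 'I_n) (h : nat) : Prop := BfsInv {
  bfs_uniq : uniq q;
  bfs_src : src \in q;
  bfs_sorted : forall i j, i <= j -> j < size q ->
     dist e src (nth x0 q i) <= dist e src (nth x0 q j);
  bfs_near : forall v, h < size q -> v \in q ->
     dist e src v <= (dist e src (nth x0 q h)).+1;
  bfs_closed : forall i w, i < h -> i < size q -> e (nth x0 q i) w -> w \in q }.

Lemma bfs_inv_init : bfs_inv [:: src] 0.
Proof.
split=> //; first by rewrite mem_head.
- by move=> [|i] [|j].
- by move=> v _; rewrite inE => /eqP ->.
Qed.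

(** Induction on the distance: the predecessor of [v] on a shortest path is in the queue and
    strictly closer than the head, so by sortedness it has been popped, and popped vertices have all
    their neighbours in the queue. *)
Lemma bfs_complete q h v : bfs_inv q h -> h < size q ->
  dist e src v <= dist e src (nth x0 q h) -> v \in q.
Proof.
move=> [uq sq so ne cl] hq; move: {2}(dist e src v) (erefl (dist e src v)) => d.
elim: d v => [|d IH] v dv le.
  have [<-//|nq] := eqVneq src v.
  by have [w _] := dist_pred e_conn nq; rewrite dv.
have [<-//|nq] := eqVneq src v.
have [w ew] := dist_pred e_conn nq; rewrite dv => -[dw].
have wq : w \in q by apply: IH => //; lia.
have iq : index w q < size q by rewrite index_mem.
apply: (@cl (index w q)) => //; last by rewrite nth_index.
rewrite ltnNge; apply/negP => hi.
by have := so _ _ hi iq; rewrite nth_index //; lia.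
Qed.

Lemma bfs_new q h w : bfs_inv q h -> h < size q -> e (nth x0 q h) w ->
  w \notin q -> dist e src w = (dist e src (nth x0 q h)).+1.
Proof.
move=> inv hq ew wq; apply/eqP; rewrite eqn_leq dist_edge //= ltnNge.
by apply: contra wq; apply: bfs_complete inv hq.
Qed.

Lemma bfs_inv_push q h w : bfs_inv q h -> h < size q -> e (nth x0 q h) w ->
  w \notin q -> bfs_inv (rcons q w) h.
Proof.
move=> inv hq ew wq; have dw := bfs_new inv hq ew wq.
case: inv => uq sq so ne cl; split.
- by rewrite rcons_uniq wq.
- by rewrite mem_rcons inE sq orbT.
- move=> i j ij; rewrite size_rcons ltnS leq_eqVlt => /orP[/eqP jq|jq]; last first.
    by rewrite !nth_rcons jq (leq_ltn_trans ij jq) so.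
  rewrite !nth_rcons jq ltnn eqxx dw.
  case: ltnP => iq; first by apply: ne => //; rewrite mem_nth.
  have -> : i == size q by apply/eqP; lia.
  by rewrite dw.
- move=> v _; rewrite mem_rcons inE nth_rcons hq => /orP[/eqP->|vq].
    by rewrite dw.
  exact: ne.
- move=> i v ih _; rewrite nth_rcons (ltn_trans ih hq) mem_rcons inE => ev.
  by rewrite (cl i) ?orbT //; lia.
Qed.

Lemma bfs_inv_pop q h : bfs_inv q h -> h < size q ->
  (forall w, e (nth x0 q h) w -> w \in q) -> bfs_inv q h.+1.
Proof.
move=> [uq sq so ne cl] hq all_in; split=> //.
- move=> v hq1 vq; apply: leq_trans (ne _ hq vq) _.
  by rewrite ltnS so.
- move=> i w; rewrite ltnS leq_eqVlt => /orP[/eqP->|ih] iq ew.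
    exact: all_in.
  exact: (cl i).
Qed.

Lemma bfs_inv_full q v : bfs_inv q (size q) -> v \in q.
Proof.
move=> [uq sq so ne cl].
have [p [pp <- _]] := shortest_path e_conn src v.
elim: p (src) sq pp => [|w p IH] u uq' //= /andP[euw pp].
apply: IH pp; apply: (cl (index u q)); rewrite ?index_mem //.
by rewrite nth_index.
Qed.

Lemma bfs_inv_size q h : bfs_inv q h -> size q <= n.
Proof. by move=> [uq _ _ _ _]; rewrite -(card_uniqP uq) -[X in _ <= X]card_ord max_card. Qed.

End BreadthFirst.

(** * Timed program logic *)

Local Notation memory := Defs.mem.

Lemma bit_length_gt0 a : 0 < bit_length a.
Proof. by []. Qed.

Lemma bit_length_ltn a j : 0 < j -> a < 2 ^ j -> bit_length a <= j.
Proof.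
rewrite /bit_length => j0 lt; case: a lt => [|a] lt; first by rewrite trunc_log0.
rewrite -(ltn_exp2l _ _ (isT : 1 < 2)).
by apply: leq_ltn_trans lt; apply: trunc_logP.
Qed.

Lemma bit_length_exp M j a : 0 < j -> a <= M ^ j -> bit_length a <= j * bit_length M.
Proof.
move=> j0 le; apply: bit_length_ltn; first by rewrite muln_gt0 j0 bit_length_gt0.
apply: leq_ltn_trans le _; rewrite mulnC expnM ltn_exp2r //.
exact: trunc_log_ltn.
Qed.

Lemma bit_length_mono a b : a <= b -> bit_length a <= bit_length b.
Proof. by move=> le; have := @bit_length_exp b 1 a isT; rewrite expn1 mul1n; apply. Qed.

(* If all stored values are at most [M >= 2], then the value of [a] is at most
   [M ^ degree a], so that evaluating [a] takes time at most
   [weight a * bit_length M]. *)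
Fixpoint degree (a : expr) : nat :=
  match a with
  | Const c => c.+1
  | Var _ | Fetch _ => 1
  | Bin _ b c => degree b + degree c
  end.

Fixpoint weight (a : expr) : nat :=
  degree a + match a with
  | Const _ | Var _ => 0
  | Fetch b => weight b
  | Bin _ b c => weight b + weight c
  end.

(* One pass through every loop body. *)
Fixpoint cmd_weight (c : cmd) : nat :=
  match c with
  | Skip | Toss _ => 1
  | Assign _ a => weight a
  | Store a b => weight a + weight b
  | Seq c1 c2 => cmd_weight c1 + cmd_weight c2
  | If a c1 c2 => weight a + (cmd_weight c1 + cmd_weight c2)
  | While a c => weight a + cmd_weight c
  end.

Fixpoint writes (c : cmd) : seq nat :=
  match c with
  | Skip | Store _ _ => [::]
  | Assign x _ | Toss x => [:: x]
  | Seq c1 c2 | If _ c1 c2 => writes c1 ++ writes c2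
  | While _ c => writes c
  end.

Lemma exec_frame c s w s' w' t : exec c s w s' w' t ->
  forall x, x \notin writes c -> vars s' x = vars s x.
Proof.
elim=> {c s w s' w' t} //=.
- by move=> x a s w y; rewrite inE /update => /negbTE ->.
- by move=> x s b w y; rewrite inE /update => /negbTE ->.
- move=> c1 c2 s1 w1 t1 s2 w2 t2 s3 w3 _ IH1 _ IH2 x.
  by rewrite mem_cat negb_or => /andP[x1 x2]; rewrite IH2 // IH1.
- move=> a c1 c2 s w s' w' t _ IH x.
  by rewrite mem_cat negb_or => /andP[x1 x2]; apply: IH; case: ifP.
- move=> a c s1 w1 t1 s2 w2 t2 s3 w3 _ _ IH1 _ IH2 x xc.
  by rewrite IH2 // IH1.
Qed.

Lemma degree_gt0 a : 0 < degree a.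
Proof. by elim: a => //= o b IHb c IHc; lia. Qed.

Lemma weight_gt0 a : 0 < weight a.
Proof. by case: a => *; rewrite ltn_addr ?degree_gt0. Qed.

Section Logic.
Variable M : nat.
Hypothesis M_ge2 : 2 <= M.

Definition bounded (s : state) :=
  (forall x, vars s x <= M) /\ (forall a, memory s a <= M).

Lemma eval_le s a : bounded s -> eval s a <= M ^ degree a.
Proof.
move=> [bv bm]; elim: a => [c|x|b IHb|o b IHb c IHc] /=.
- by apply: leq_trans (ltnW (ltn_expl c.+1 M_ge2)).
- by rewrite expn1.
- by rewrite expn1.
- have mul_le : eval s b * eval s c <= M ^ (degree b + degree c).
    by rewrite expnD leq_mul.
  (* Both powers are at least 2, where a sum is at most the product; so addition raises the degree
     no more than multiplication. *)
  have le_add u v : M ^ degree b <= u -> M ^ degree c <= v ->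
       M ^ degree b + M ^ degree c <= u * v.
    have pb : 2 <= M ^ degree b.
      by apply: leq_trans M_ge2 _; rewrite -{1}(expn1 M) leq_pexp2l ?degree_gt0 //; lia.
    have pc : 2 <= M ^ degree c.
      by apply: leq_trans M_ge2 _; rewrite -{1}(expn1 M) leq_pexp2l ?degree_gt0 //; lia.
    move: (M ^ degree b) (M ^ degree c) pb pc => i j pb pc iu jv.
    by apply: (@leq_trans (i * j)); [nia | rewrite leq_mul].
  have {}le_add : M ^ degree b + M ^ degree c <= M ^ (degree b + degree c).
    by rewrite expnD; apply: le_add.
  case: o => //=.
  + by apply: leq_trans le_add; rewrite leq_add.
  + apply: leq_trans (leq_subr _ _) _; apply: leq_trans IHb _.
    by rewrite leq_pexp2l //; lia.
  + apply: leq_trans (leq_div _ _) _; apply: leq_trans IHb _.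
    by rewrite leq_pexp2l //; lia.
Qed.

Lemma cost_le s a : bounded s -> cost s a <= weight a * bit_length M.
Proof.
move=> bs.
have node b : bit_length (eval s b) <= degree b * bit_length M.
  by apply: bit_length_exp; [apply: degree_gt0 | apply: eval_le].
elim: a => [c|x|b IHb|o b IHb c IHc].
- by have := node (Const c); rewrite /= !addn0.
- by have := node (Var x); rewrite /= !addn0.
- by rewrite [weight _]/= mulnDl leq_add //; have := node (Fetch b).
- by rewrite [weight _]/= !mulnDl leq_add ?leq_add //; have := node (Bin o b c); rewrite /= mulnDl.
Qed.

Lemma bounded_set_var s x a : bounded s -> a <= M -> bounded (set_var s x a).
Proof. by move=> [bv bm] aM; split=> //= y; rewrite /update; case: ifP. Qed.

Lemma bounded_set_mem s x a : bounded s -> a <= M -> bounded (set_mem s x a).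
Proof. by move=> [bv bm] aM; split=> //= y; rewrite /update; case: ifP. Qed.

(* Time is counted in units of [bit_length M]. *)
Definition hoare (c : cmd) (s : state) (w : seq bool) (T : nat)
    (Q : state -> seq bool -> Prop) : Prop :=
  bounded s -> exists s' w' t,
    [/\ exec c s w s' w' t, t <= T * bit_length M, bounded s' & Q s' w'].

(** The new postcondition may use that variables outside [writes c] keep their values, so
    specifications need not list them. *)
Lemma hoare_weaken c s w T T' (Q Q' : state -> seq bool -> Prop) :
  hoare c s w T Q -> T <= T' ->
  (forall s' w', bounded s' -> (forall x, x \notin writes c -> vars s' x = vars s x) ->
     Q s' w' -> Q' s' w') -> hoare c s w T' Q'.
Proof.
move=> hc TT QQ bs; have [s' [w' [t [ex le bs' Qs]]]] := hc bs.
exists s', w', t; split=> //; first by apply: leq_trans le _; rewrite leq_mul2r TT orbT.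
by apply: QQ => //; apply: exec_frame ex.
Qed.

Lemma hoare_seq c1 c2 s w T1 T2 T Q :
  hoare c1 s w T1 (fun s1 w1 => hoare c2 s1 w1 T2 Q) -> T1 + T2 <= T ->
  hoare (Seq c1 c2) s w T Q.
Proof.
move=> h1 TT bs; have [s1 [w1 [t1 [ex1 le1 bs1 h2]]]] := h1 bs.
have [s2 [w2 [t2 [ex2 le2 bs2 Qs]]]] := h2 bs1.
exists s2, w2, (t1 + t2); split=> //; first exact: ExecSeq ex1 ex2.
apply: (@leq_trans ((T1 + T2) * bit_length M)); last by rewrite leq_mul2r TT orbT.
by rewrite mulnDl leq_add.
Qed.

Lemma hoare_if a c1 c2 s w T T' Q :
  hoare (if eval s a != 0 then c1 else c2) s w T Q -> weight a + T <= T' ->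
  hoare (If a c1 c2) s w T' Q.
Proof.
move=> h le bs; have [s1 [w1 [t1 [ex1 le1 bs1 Q1]]]] := h bs.
exists s1, w1, (cost s a + t1); split=> //; first exact: ExecIf.
apply: (@leq_trans ((weight a + T) * bit_length M)); last by rewrite leq_mul2r le orbT.
by rewrite mulnDl leq_add // cost_le.
Qed.

Lemma hoare_toss x s (b : bool) w (Q : state -> seq bool -> Prop) :
  Q (set_var s x b) w -> hoare (Toss x) s (b :: w) 1 Q.
Proof.
move=> Qs bs; exists (set_var s x b), w, 1; split=> //; first exact: ExecToss.
by apply: bounded_set_var => //; case: b {Qs}; apply: leq_trans M_ge2.
Qed.

(* The invariant carries the remaining time budget, which also proves
   termination. *)
Lemma hoare_while (I : state -> seq bool -> nat -> Prop) a c s w T Q :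
  I s w T ->
  (forall s w T, bounded s -> I s w T -> eval s a = 0 -> weight a <= T /\ Q s w) ->
  (forall s w T, bounded s -> I s w T -> eval s a != 0 -> exists T1 T2,
      weight a + T1 + T2 <= T /\ hoare c s w T1 (fun s' w' => I s' w' T2)) ->
  hoare (While a c) s w T Q.
Proof.
move=> I0 Istop Iloop.
elim/ltn_ind: T s w I0 => T IH s w I0 bs.
have [e0|e0] := eqVneq (eval s a) 0.
  have [le Qs] := Istop _ _ _ bs I0 e0.
  exists s, w, (cost s a); split=> //; first exact: ExecWhileStop.
  by apply: leq_trans (cost_le a bs) _; rewrite leq_mul2r le orbT.
have [T1 [T2 [le hc]]] := Iloop _ _ _ bs I0 e0.
have [s1 [w1 [t1 [ex1 le1 bs1 I1]]]] := hc bs.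
have lt : T2 < T by have := weight_gt0 a; lia.
have [s2 [w2 [t2 [ex2 le2 bs2 Qs]]]] := IH _ lt _ _ I1 bs1.
exists s2, w2, (cost s a + t1 + t2); split=> //; first exact: ExecWhileLoop ex1 ex2.
apply: (@leq_trans ((weight a + T1 + T2) * bit_length M)); last first.
  by rewrite leq_mul2r le orbT.
by rewrite !mulnDl !leq_add // cost_le.
Qed.

(** Weakest preconditions for straight-line code; tosses and loops have their own rules, hence
    [False]. Only stored values must be at most [M]; addresses merely cost time. *)
Fixpoint wp (c : cmd) (s : state) (Q : state -> Prop) : Prop :=
  match c with
  | Skip => Q s
  | Assign x a => eval s a <= M /\ Q (set_var s x (eval s a))
  | Store a b => eval s b <= M /\ Q (set_mem s (eval s a) (eval s b))
  | Seq c1 c2 => wp c1 s (fun s1 => wp c2 s1 Q)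
  | If a c1 c2 => if eval s a != 0 then wp c1 s Q else wp c2 s Q
  | Toss _ | While _ _ => False
  end.

Lemma wp_mono c s (Q Q' : state -> Prop) :
  (forall s, Q s -> Q' s) -> wp c s Q -> wp c s Q'.
Proof.
elim: c s Q Q' => //= [s Q Q' QQ|x a s Q Q' QQ|a b s Q Q' QQ|c1 IH1 c2 IH2 s Q Q' QQ|a c1 IH1 c2 IH2 s Q Q' QQ].
- exact: QQ.
- by case=> le /QQ.
- by case=> le /QQ.
- by apply: IH1 => s1; apply: IH2.
- by case: ifP => _; [apply: IH1|apply: IH2].
Qed.

Lemma hoare_wp c s w (Q : state -> seq bool -> Prop) :
  wp c s (fun s' => Q s' w) -> hoare c s w (cmd_weight c) Q.
Proof.
elim: c s w Q => //= [s w Q Qs bs|x a s w Q [le Qs] bs|a b s w Q [le Qs] bs|c1 IH1 c2 IH2 s w Q h|a c1 IH1 c2 IH2 s w Q h].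
- by exists s, w, 1; split=> //; exact: ExecSkip.
- exists (set_var s x (eval s a)), w, (cost s a); split=> //.
  + exact: ExecAssign.
  + exact: cost_le.
  + exact: bounded_set_var.
- exists (set_mem s (eval s a) (eval s b)), w, (cost s a + cost s b); split=> //.
  + exact: ExecStore.
  + by rewrite mulnDl leq_add // cost_le.
  + exact: bounded_set_mem.
- apply: hoare_seq (leqnn _); apply: IH1; apply: wp_mono h => s1; exact: IH2.
- apply: (hoare_if _ (leqnn _)); case: ifP h => _ h.
  + by apply: hoare_weaken (IH1 _ _ _ h) _ _ => //; apply: leq_addr.
  + by apply: hoare_weaken (IH2 _ _ _ h) _ _ => //; apply: leq_addl.
Qed.

Lemma hoare_wp_le c s w T (Q : state -> seq bool -> Prop) :
  cmd_weight c <= T -> wp c s (fun s' => Q s' w) -> hoare c s w T Q.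
Proof. by move=> le h; apply: hoare_weaken (hoare_wp h) le _. Qed.

Definition upto (iv nv : nat) (c : cmd) : cmd :=
  While (Bin Defs.Sub (Var nv) (Var iv)) (Seq c (Assign iv (Bin Add (Var iv) (Const 1)))).

(** The guard weighs 4 and the increment 6, which makes 10 per pass besides the body; the leading 6
    covers the last test of the guard. The invariant is indexed by the counter and has to tolerate
    writing the counter variable. *)
Lemma hoare_upto iv nv c s w N (I : nat -> state -> Prop) (t : nat -> nat) :
  iv != nv -> iv \notin writes c -> nv \notin writes c ->
  vars s nv = N -> vars s iv <= N -> I (vars s iv) s ->
  (forall i s, I i s -> I i (set_var s iv i)) ->
  (forall i s, i < N -> bounded s -> vars s iv = i -> vars s nv = N -> I i s ->
     hoare c s w (t i) (fun s' w' => w' = w /\ I i.+1 s')) ->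
  hoare (upto iv nv c) s w (6 + \sum_(vars s iv <= i < N) (t i + 10))
    (fun s' w' => w' = w /\ I N s').
Proof.
move=> ivnv ivc nvc sN le I0 Istab body.
apply: (hoare_while (I := fun s w' T => [/\ w' = w, vars s nv = N, vars s iv <= N,
   I (vars s iv) s & T = 6 + \sum_(vars s iv <= i < N) (t i + 10)])) => //.
- move=> {s sN le I0} s _ T bs [-> sN le Is ->] /= e0; split; first by lia.
  by have <- : vars s iv = N by lia.
- move=> {s sN le I0} s _ T bs [-> sN le Is ->] /= e0.
  have lt : vars s iv < N by lia.
  exists (t (vars s iv) + 6), (6 + \sum_((vars s iv).+1 <= i < N) (t i + 10)); split.
    by rewrite [X in _ <= _ + X]big_ltn //; lia.
  apply: hoare_seq (leqnn _).
  apply: hoare_weaken (body _ _ lt bs _ _ Is) (leqnn _) _ => //.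
  move=> s1 _ bs1 frame [-> I1]; apply: (@hoare_wp (Assign _ _)) => /=.
  rewrite !frame // addn1; split; first by case: bs => bv _; apply: leq_trans lt _; rewrite -sN.
  rewrite /update eqxx eq_sym (negbTE ivnv); split=> //; first by rewrite frame.
  exact: Istab.
Qed.

End Logic.

Arguments weight : simpl never.
Arguments cmd_weight : simpl never.

(** * The program *)

Declare Scope prog_scope.
Delimit Scope prog_scope with P.

Section Code.
Local Notation "$ x" := (Var x) (at level 5, format "$ x") : prog_scope.
Local Notation "# c" := (Const c) (at level 5, format "# c") : prog_scope.
Local Notation "@[ a ]" := (Fetch a) (at level 5) : prog_scope.
Local Notation "a + b" := (Bin Add a b) : prog_scope.
Local Notation "a - b" := (Bin Defs.Sub a b) : prog_scope.
Local Notation "a * b" := (Bin Mul a b) : prog_scope.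
Local Notation "a / b" := (Bin Div a b) : prog_scope.
Local Notation "x ::= a" := (Assign x a) (at level 80) : prog_scope.
Local Notation "a <== b" := (Store a b) (at level 80) : prog_scope.
Local Notation "c1 ;; c2" := (Seq c1 c2) (at level 85, right associativity) : prog_scope.
(* Variables: 0 radius of the current candidate plus one (finally the output),
   1 n, 2 min(k, n), 3 to 6 addresses of arrays of length n (distances plus one
   from the source of the last search, its queue, maximal distance plus one to
   the searched sources, distances plus one from the candidate), 7 number of
   samples, 8 power of two, 9 coin, 10 source of the search, 11 remaining
   rounds, 12 whether the last round searched, 13 candidate, 14 loop counter of
   a round, 15 queue head, 16 queue tail, 17 popped vertex, 18 and 19 bounds of
   its unread neighbours, 20 neighbour, 21 loop counter. *)
Definition scan_body : cmd :=
  (20 ::= @[$1 + #3 + $18] ;;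
   If @[$3 + $20] Skip
     ($3 + $20 <== @[$3 + $17] + #1 ;; $4 + $16 <== $20 ;; 16 ::= $16 + #1))%P.

(** Input cells [2 + u] and [3 + u] hold the start and the end of the list of [u], relative to the
    address [n + 3] of the concatenated lists, which [scan_body] adds. *)
Definition bfs_pop : cmd :=
  (17 ::= @[$4 + $15] ;; 18 ::= @[#2 + $17] ;; 19 ::= @[#3 + $17])%P.

Definition bfs_start : cmd :=
  ($3 + $10 <== #1 ;; $4 <== $10 ;; 15 ::= #0 ;; 16 ::= #1)%P.

Definition bfs_clear : cmd := ($3 + $21 <== #0)%P.

Definition bfs : cmd :=
  (21 ::= #0 ;; upto 21 1 bfs_clear ;; bfs_start ;;
   While ($16 - $15) (bfs_pop ;; upto 18 19 scan_body ;; 15 ::= $15 + #1))%P.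

(** Subtraction is truncated, so a nonzero difference tests for strictly greater; the other
    comparisons work the same way. *)
Definition merge_body : cmd :=
  (If (@[$3 + $21] - @[$5 + $21]) ($5 + $21 <== @[$3 + $21]) Skip)%P.

Definition add_source : cmd := (bfs ;; 21 ::= #0 ;; upto 21 1 merge_body)%P.

Definition argmin_body : cmd :=
  (If ($0 - @[$5 + $21]) (0 ::= @[$5 + $21] ;; 13 ::= $21) Skip)%P.

Definition argmin_start : cmd := (13 ::= #0 ;; 0 ::= @[$5] ;; 21 ::= #0)%P.

Definition argmin : cmd := (argmin_start ;; upto 21 1 argmin_body)%P.

Definition copy_body : cmd := ($6 + $21 <== @[$3 + $21])%P.

Definition far_body : cmd :=
  (If (@[$6 + $14] - $0) ((12 ::= #1 ;; 10 ::= $14) ;; add_source) Skip)%P.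

Definition round : cmd :=
  ((12 ::= #0 ;; 10 ::= $13) ;; bfs ;; 21 ::= #0 ;; upto 21 1 copy_body ;;
   14 ::= #0 ;; upto 14 1 far_body ;; argmin ;; 11 ::= $11 - #1)%P.

Definition toss_body : cmd := (Toss 9 ;; (10 ::= #2 * $10 + $9 ;; 8 ::= #2 * $8))%P.

(** Doubling a bound until it reaches [n] avoids a logarithm; the last assignment is the remainder
    modulo [n], expressed by division. *)
Definition sample : cmd :=
  ((10 ::= #0 ;; 8 ::= #1) ;; While ($1 - $8) toss_body ;;
   10 ::= $10 - ($10 / $1) * $1)%P.

(** Comparing squares in the guard avoids computing a square root. *)
Definition sampling : cmd :=
  (While ($2 * $1 - $7 * $7) (7 ::= $7 + #1 ;; sample ;; add_source))%P.

(** The product in the guard is a conjunction: the last round searched and rounds remain. The final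
    decrement undoes the plus one of stored distances. *)
Definition rounds : cmd :=
  (argmin ;; (12 ::= #1 ;; 11 ::= $2) ;; While ($12 * $11) round ;; 0 ::= $0 - #1)%P.

Definition setup : cmd :=
  (1 ::= @[#0] ;; 2 ::= @[#1] ;; 3 ::= $1 + #3 + @[#2 + $1] ;;
   4 ::= $3 + $1 ;; 5 ::= $4 + $1 ;; 6 ::= $5 + $1)%P.

(* Bounding k by n first keeps all numbers polynomial in n. *)
Definition cap_k : cmd := (If (@[#1] - @[#0]) (#1 <== @[#0]) Skip)%P.

Definition radius_cmd : cmd := (cap_k ;; setup ;; sampling ;; rounds)%P.

End Code.

Lemma updateE f x a y : update f x a y = if y == x then a else f y.
Proof. by []. Qed.

Local Ltac split_and := repeat match goal with |- _ /\ _ => split end.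

(** * Memory layout, and the searches and rounds as executed by the machine *)

Section Program.
Variables (n kk : nat) (e : rel 'I_n) (adj : 'I_n -> seq 'I_n).
Hypotheses (e_sym : symmetric e) (e_conn : connected_graph e).
Hypothesis adjP : adjacency_lists e adj.
Hypothesis kk_le : kk <= n.

Definition offset (i : nat) : nat := \sum_(u < n | u < i) size (adj u).

Lemma offsetS (u : 'I_n) : offset u.+1 = offset u + size (adj u).
Proof.
rewrite /offset (bigD1 u) //= addnC; congr (_ + _); apply: eq_bigl => v.
by rewrite ltnS [v <= u]leq_eqVlt -(inj_eq val_inj) /=; case: eqP => [->|]; rewrite ?ltnn //= ?andbT.
Qed.

Lemma offset_le i : offset i <= offset n.
Proof.
rewrite /offset [X in _ <= X](eq_bigl xpredT); last by move=> u; rewrite ltn_ord.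
by rewrite [X in _ <= X](bigID (fun u : 'I_n => u < i)) /= leq_addr.
Qed.

(** The length of the input, hence the first free address. *)
Definition work : nat := n + 3 + offset n.
Definition max_value : nat := work + 5 * n + 5.
Local Notation hoare := (hoare max_value).
Local Notation bounded := (bounded max_value).

Lemma max_value_ge2 : 2 <= max_value.
Proof. by rewrite /max_value !addnS. Qed.
Local Hint Resolve max_value_ge2 : core.

Record env (s : state) : Prop := Env {
  env1 : vars s 1 = n;
  env2 : vars s 2 = kk;
  env3 : vars s 3 = work;
  env4 : vars s 4 = work + n;
  env5 : vars s 5 = work + 2 * n;
  env6 : vars s 6 = work + 3 * n;
  env_off : forall i, i <= n -> memory s (2 + i) = offset i;
  env_adj : forall (u x0 : 'I_n) j, j < size (adj u) ->
    memory s (n + 3 + (offset u + j)) = nth x0 (adj u) j }.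

Lemma env_frame s s' : env s ->
  (forall x, 1 <= x <= 6 -> vars s' x = vars s x) ->
  (forall a, a < work -> memory s' a = memory s a) -> env s'.
Proof.
move=> [e1 e2 e3 e4 e5 e6 eo ea] vs ms; split; rewrite ?vs //.
- by move=> i le; rewrite ms ?eo // /work; lia.
- move=> u x0 j lt; rewrite ms ?(ea _ x0) // /work.
  by have := offset_le u.+1; rewrite offsetS; lia.
Qed.

Definition same_outside (lo hi : nat) (s s' : state) :=
  forall a, ~~ (lo <= a < hi) -> memory s' a = memory s a.

Section Search.
Variables (src : 'I_n) (s0 : state).

Record searching (s : state) (q : seq 'I_n) (h : nat) : Prop := Searching {
  sg_env : env s;
  sg_inv : bfs_inv e src src q h;
  sg_head : vars s 15 = h;
  sg_tail : vars s 16 = size q;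
  sg_dist : forall v : 'I_n,
    memory s (work + v) = if v \in q then (dist e src v).+1 else 0;
  sg_queue : forall i, i < size q -> memory s (work + n + i) = nth src q i;
  sg_frame : same_outside work (work + 2 * n) s0 s }.

Lemma searching_vars s s' q h : searching s q h -> memory s' = memory s ->
  (forall x, x \in [:: 1; 2; 3; 4; 5; 6; 15; 16] -> vars s' x = vars s x) ->
  searching s' q h.
Proof.
move=> [en inv hd tl di qu fr] me va; split=> //; rewrite /same_outside ?me //.
- apply: env_frame en _ _ => [x|a _]; last by rewrite me.
  by move=> le; apply: va; rewrite !inE; lia.
- by rewrite va.
- by rewrite va.
Qed.

Lemma hoare_scan s w q h i : searching s q h -> h < size q ->
  vars s 17 = nth src q h -> vars s 18 = offset (nth src q h) + i ->
  i < size (adj (nth src q h)) ->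
  hoare scan_body s w (cmd_weight scan_body) (fun s' w' => w' = w /\
    exists q', [/\ searching s' q' h, h < size q', nth src q' h = nth src q h,
      prefix q q' & nth src (adj (nth src q h)) i \in q']).
Proof.
move=> sg hq v17 v18 lti; have [en inv hd tl di qu fr] := sg.
set u := nth src q h in v17 v18 lti *.
set v := nth src (adj u) i.
have euv : e u v by rewrite -(adjP u).2 mem_nth.
have bnd := bfs_inv_size inv.
apply: hoare_wp => //=.
rewrite /= ?updateE /= !(env1 en) !(env3 en) !(env4 en) v17 v18 tl (env_adj en src) // -/v.
split; first by rewrite /max_value; have := ltn_ord v; lia.
rewrite di; have [vq|vq] /= := boolP (v \in q).
  split=> //; exists q; split; rewrite ?prefix_refl //.
  by apply: searching_vars sg _ _ => // x xi; rewrite /= updateE; case: eqP xi => // ->.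
have qlt : size q < n.
  have := @max_card _ (mem (rcons q v)); rewrite card_ord.
  rewrite (card_uniqP _) ?size_rcons // rcons_uniq vq; exact: bfs_uniq inv.
have uq : u \in q by rewrite mem_nth.
have ltd := dist_lt_card e_conn src u; rewrite card_ord in ltd.
rewrite di uq.
do !split.
- by rewrite /max_value; lia.
- by rewrite /max_value; have := ltn_ord v; lia.
- by rewrite /max_value; lia.
exists (rcons q v); split; first 1 last.
- by rewrite size_rcons; lia.
- by rewrite nth_rcons hq.
- exact: prefix_rcons.
- by rewrite mem_rcons mem_head.
have dv := bfs_new e_conn inv hq euv vq.
split=> //=.
- apply: env_frame en _ _ => /= [x lx|a la]; rewrite !updateE.
    by do 2!(case: eqP; first by lia).
  by do 2!(case: eqP; first by have := ltn_ord v; lia).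
- by apply: bfs_inv_push.
- by rewrite size_rcons addn1.
- move=> z; rewrite !updateE mem_rcons inE di -(inj_eq val_inj) eqn_add2l.
  case: eqP => [|_]; first by have := ltn_ord z; lia.
  by case: eqP => //= /val_inj ->; rewrite dv addn1.
- move=> j; rewrite size_rcons ltnS nth_rcons !updateE => lej.
  case: eqP => [/addnI ->|ne]; first by rewrite ltnn eqxx.
  have ltj : j < size q by lia.
  by rewrite ltj; case: eqP; [have := ltn_ord v; lia | rewrite qu].
- move=> a na; rewrite /= !updateE.
  by do 2!(case: eqP; first by have := ltn_ord v; lia); move=> _ _; apply: fr.
Qed.

Lemma hoare_scan_all s w q h : searching s q h -> h < size q ->
  vars s 17 = nth src q h -> vars s 18 = offset (nth src q h) ->
  vars s 19 = offset (nth src q h).+1 ->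
  hoare (upto 18 19 scan_body) s w
    (6 + size (adj (nth src q h)) * (cmd_weight scan_body + 10))
    (fun s' w' => w' = w /\
      exists q', [/\ searching s' q' h, h < size q', nth src q' h = nth src q h, prefix q q'
        & forall v, e (nth src q h) v -> v \in q']).
Proof.
move=> sg hq v17 v18 v19; set u := nth src q h in v17 v18 v19 *.
pose I i s' := exists q', [/\ searching s' q' h, h < size q', nth src q' h = u,
  prefix q q' & [/\ vars s' 17 = u, offset u <= i
  & forall j, j < size (adj u) -> offset u + j < i -> nth src (adj u) j \in q']].
have := @hoare_upto max_value max_value_ge2 18 19 scan_body s w (offset u.+1) I
  (fun=> cmd_weight scan_body).
rewrite sum_nat_const_nat v18 offsetS => H.
apply: hoare_weaken (H _ _ _ _ _ _ _ _) _ _ => //.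
- by rewrite v19 offsetS.
- by rewrite leq_addr.
- by exists q; split; rewrite ?prefix_refl //; split=> // j _; lia.
- move=> i s1 [q' [sg' hq' nq' pq' [v17' lei Iq]]]; exists q'; split=> //.
  by apply: searching_vars sg' _ _ => // x xi; rewrite /= updateE; case: eqP xi => // ->.
- move=> i s1 lti bs1 v18' v19' [q' [sg' hq' nq' pq' [v17' lei Iq]]].
  apply: hoare_weaken (@hoare_scan s1 w q' h (i - offset u) sg' hq' _ _ _) (leqnn _) _.
  + by rewrite nq'.
  + by rewrite nq' subnKC.
  + by rewrite nq'; lia.
  + move=> s2 _ bs2 fr [-> [q2 [sg2 hq2 nq2 pq2 inq]]]; split=> //.
    exists q2; split; rewrite ?nq2 ?nq' ?(prefix_trans pq' pq2) //; split; rewrite ?fr ?leqW //.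
    move=> j ltj; rewrite ltnS leq_eqVlt => /orP[/eqP ej|lt].
      by rewrite -nq'; have -> : j = i - offset u by lia.
    by case/prefixP: pq2 => r ->; rewrite mem_cat Iq.
- by lia.
- move=> s1 w1 bs1 fr [-> [q' [sg' hq' nq' pq' [v17' lei Iq]]]]; split=> //.
  exists q'; split=> // v; rewrite -(adjP u).2 => vu.
  by rewrite -(nth_index src vu); apply: Iq; rewrite ?ltn_add2l index_mem.
Qed.

Definition bfs_time : nat :=
  (cmd_weight bfs + 100) * (n + offset n + 1).

Lemma hoare_bfs w : env s0 -> vars s0 10 = src ->
  hoare bfs s0 w bfs_time (fun s' w' => [/\ w' = w,
    forall v : 'I_n, memory s' (work + v) = (dist e src v).+1 &
    same_outside work (work + 2 * n) s0 s']).
Proof.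
move=> en v10.
(* 16 is the guard 4 of the main loop, the overhead 6 of [upto] and the increment 6 of the queue
   head. *)
pose cA := cmd_weight bfs_pop + 16; pose cB := cmd_weight scan_body + 10.
pose TB := 4 + \sum_(v : 'I_n) (cA + cB * size (adj v)).
have n0 := leq_ltn_trans (leq0n _) (ltn_ord src).
apply: (hoare_seq (T1 := 1) (T2 := 6 + n * (cmd_weight bfs_clear + 10) + (cmd_weight bfs_start + TB))); last first.
  have -> : TB = 4 + (n * cA + cB * offset n).
    rewrite /TB big_split /= sum_nat_const card_ord -big_distrr /=.
    by congr (_ + (_ + _ * _)); apply: eq_bigl => u; rewrite ltn_ord.
  have le1 : cmd_weight bfs_clear + 10 + cA <= cmd_weight bfs + 100 by [].
  have le2 : cB <= cmd_weight bfs + 100 by [].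
  have le3 : 1 + (6 + (cmd_weight bfs_start + 4)) <= cmd_weight bfs + 100 by [].
  rewrite /bfs_time; move: (cmd_weight bfs + _) le1 le2 le3 => c le1 le2 le3; nia.
apply: (@hoare_wp max_value max_value_ge2 (Assign _ _)) => /=; split=> //.
apply: hoare_seq (leqnn _).
pose I i s' := [/\ env s', vars s' 10 = src, same_outside work (work + 2 * n) s0 s'
  & forall v : 'I_n, v < i -> memory s' (work + v) = 0].
have := @hoare_upto max_value max_value_ge2 21 1 bfs_clear (set_var s0 21 0) w n I
  (fun=> cmd_weight bfs_clear).
rewrite sum_nat_const_nat subn0 => H.
apply: hoare_weaken (H _ _ _ _ _ _ _ _) _ _ => //.
- exact: env1 en.
- split=> //.
  by apply: env_frame en _ _ => //= x lx; rewrite updateE; case: eqP => //; lia.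
- move=> i s1 [en1 v101 fr1 z1]; split=> //.
  by apply: env_frame en1 _ _ => //= x lx; rewrite updateE; case: eqP => //; lia.
- move=> i s1 lti bs1 v21 _ [en1 v101 fr1 z1].
  apply: hoare_wp => //.
  rewrite /= (env3 en1) v21; do 2!split=> //; split=> //=.
  + by apply: env_frame en1 _ _ => //= a la; rewrite updateE; case: eqP => //; lia.
  + by move=> a na /=; rewrite updateE; case: eqP => [|_]; [lia|apply: fr1].
  + move=> v lv; rewrite updateE; case: eqP => // ne; apply: z1; lia.
move=> s1 _ bs1 _ [-> [en1 v101 fr1 z1]].
apply: hoare_seq (leqnn _).
apply: hoare_wp => //; rewrite /= (env3 en1) (env4 en1) v101.
split_and; try by rewrite /max_value; have := ltn_ord src; lia.
set s2 := set_var _ 16 1.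
have sg2 : searching s2 [:: src] 0.
  split=> //=.
  - apply: env_frame en1 _ _ => /= [x lx|a la]; rewrite !updateE.
      by do 2!(case: eqP; first by lia).
    by do 2!(case: eqP; first by have := ltn_ord src; lia).
  - exact: bfs_inv_init.
  - move=> v; rewrite !updateE inE -(inj_eq val_inj) !eqn_add2l.
    case: eqP => [|_]; first by have := ltn_ord v; lia.
    by case: eqP => [/val_inj ->|_]; rewrite ?dist_refl ?z1.
  - by move=> [|i] //= _; rewrite addn0 updateE eqxx.
  - move=> a na; rewrite /= !updateE.
    do 2!(case: eqP; first by have := ltn_ord src; lia).
    by move=> _ _; apply: fr1.
(* The remaining budget charges every vertex outside the popped prefix [take h q] for its pop and
   its list; popping the head releases exactly its summand, and the 4 pays for the last test of the
   guard. *)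
apply: (hoare_while max_value_ge2 (I := fun s w' T => w' = w /\ exists q h,
   [/\ searching s q h, h <= size q &
   T = 4 + \sum_(v : 'I_n | v \notin take h q) (cA + cB * size (adj v))])).
- split=> //; exists [:: src], 0; split=> //.
- move=> s3 _ T bs3 [-> [q [h [sg hq ->]]]] /=; rewrite (sg_tail sg) (sg_head sg) => e0.
  have {e0} eh : h = size q by lia.
  subst h; have inv := sg_inv sg.
  split; first exact: leq_addr.
  split=> // [v|]; last exact: sg_frame sg.
  by rewrite (sg_dist sg) (bfs_inv_full e_conn v inv).
- move=> s3 _ T bs3 [-> [q [h [sg hq ->]]]] /=; rewrite (sg_tail sg) (sg_head sg) => e0.
  have {e0}hq : h < size q by lia.
  have inv := sg_inv sg.
  set u := nth src q h.
  have uh : u \notin take h q.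
    rewrite -has_pred1 has_take_leq ?(ltnW hq) // -leqNgt.
    have -> : find (pred1 u) q = index u q by [].
    by rewrite index_uniq // (bfs_uniq inv).
  exists (cmd_weight bfs_pop + (6 + size (adj u) * cB + 6)),
     (4 + \sum_(v : 'I_n | v \notin take h.+1 q) (cA + cB * size (adj v))); split.
    rewrite [X in _ <= _ + X](bigD1 u) //=.
    rewrite (eq_bigl (fun v : 'I_n => (v \notin take h q) && (v != u))); last first.
      by move=> v; rewrite (take_nth src) // mem_rcons inE negb_or andbC.
    move: (bigop.body _ _ _) => X; change (weight _) with 4; rewrite [size _ * _]mulnC /cA; move: (cB * _) => Y; lia.
  apply: hoare_seq (leqnn _); apply: hoare_wp => //=.
  rewrite ?updateE /= (env4 (sg_env sg)) (sg_head sg) (sg_queue sg) // -/u ?updateE /=.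
  rewrite !(env_off (sg_env sg)); try by have := ltn_ord u; lia.
  have := offset_le u.+1; rewrite offsetS => ole.
  split_and; try by rewrite /max_value /work; have := ltn_ord u; lia.
  set s4 := set_var _ 19 _.
  have sg4 : searching s4 q h.
    by apply: searching_vars sg _ _ => // x xi; rewrite /s4 /= !updateE; do 3!(case: eqP xi => [->|_ xi] //).
  apply: hoare_seq (leqnn _).
  apply: hoare_weaken (@hoare_scan_all s4 w q h sg4 hq _ _ _) _ _ => //=.
  - by rewrite offsetS.
  - move=> s5 _ bs5 fr5 [-> [q5 [sg5 hq5 nq5 pq5 all5]]].
    apply: (@hoare_wp max_value max_value_ge2 (Assign _ _)) => /=; rewrite (sg_head sg5).
    have := bfs_inv_size (sg_inv sg5) => sz.
    split; first by rewrite /max_value; lia.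
    split=> //; exists q5, h.+1; split=> //; last first.
    - by case/prefixP: pq5 => r ->; rewrite takel_cat.
    - case: (sg5) => en5 inv5 hd5 tl5 di5 qu5 fr5'; split=> //=; rewrite ?updateE ?addn1 //=.
      - by apply: env_frame en5 _ _ => //= x lx; rewrite updateE; case: eqP => //; lia.
      - by apply: bfs_inv_pop => //; rewrite nq5.
Qed.

End Search.

(** With the plus one, an empty list of sources gives 0, the content of untouched memory. *)
Definition reach (U : seq 'I_n) (v : 'I_n) : nat := \max_(u <- U) (dist e u v).+1.

Definition covered (s : state) (U : seq 'I_n) :=
  forall v : 'I_n, memory s (work + 2 * n + v) = reach U v.

Lemma reach_le U v : reach U v <= n.
Proof.
apply/bigmax_leqP_seq => u _ _.
by have := dist_lt_card e_conn u v; rewrite card_ord.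
Qed.

Lemma env_vars s s' : env s -> memory s' = memory s ->
  (forall x, 1 <= x <= 6 -> vars s' x = vars s x) -> env s'.
Proof. by move=> en me va; apply: env_frame en va _ => a _; rewrite me. Qed.

Local Ltac frame_vars := by move=> ? ?; rewrite /= ?updateE; repeat (case: eqP => //; first by lia).

Definition add_time : nat := bfs_time + (1 + (6 + n * (cmd_weight merge_body + 10))).

Lemma hoare_add_source s w U (src : 'I_n) : env s -> vars s 10 = src -> covered s U ->
  hoare add_source s w add_time (fun s' w' => [/\ w' = w, env s', covered s' (src :: U)
    & same_outside work (work + 3 * n) s s']).
Proof.
move=> en v10 cov; apply: hoare_seq (leqnn _).
apply: hoare_weaken (hoare_bfs w en v10) (leqnn _) _.
move=> s1 _ bs1 fr1 [-> di1 so1]; apply: hoare_seq (leqnn _).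
have en1 : env s1.
  apply: env_frame en _ _ => [x lx|a la]; last by apply: so1; lia.
  by apply: fr1; case: x lx => [|[|[|[|[|[|[|x]]]]]]].
apply: (@hoare_wp max_value max_value_ge2 (Assign _ _)) => /=; split=> //.
pose I i s' := [/\ env s', same_outside work (work + 3 * n) s s',
  (forall v : 'I_n, memory s' (work + v) = (dist e src v).+1)
  & forall v : 'I_n, memory s' (work + 2 * n + v) = reach (if v < i then src :: U else U) v].
have := @hoare_upto max_value max_value_ge2 21 1 merge_body (set_var s1 21 0) w n I
  (fun=> cmd_weight merge_body).
rewrite sum_nat_const_nat subn0 => H.
apply: hoare_weaken (H _ _ _ _ _ _ _ _) _ _ => //.
- exact: env1 en1.
- split=> //.
  + apply: env_vars en1 _ _ => //; frame_vars.
  + by move=> a na; apply: so1; lia.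
  + by move=> v /=; rewrite so1 ?cov //; have := ltn_ord v; lia.
- move=> i s2 [en2 so2 di2 re2]; split=> //.
  apply: env_vars en2 _ _ => //; frame_vars.
- move=> i s2 lti bs2 v21 _ [en2 so2 di2 re2].
  apply: hoare_wp => //.
  pose v := Ordinal lti.
  have Ev : memory s2 (work + 2 * n + i) = reach U v by rewrite (re2 v) ltnn.
  rewrite /= (env3 en2) (env5 en2) v21 (di2 v) Ev.
  case: ifP => cmp.
  + have ltd := dist_lt_card e_conn src v; rewrite card_ord in ltd.
    split; first by rewrite /max_value; lia.
    split=> //; split=> //=.
    * by apply: env_frame en2 _ _ => //= a la; rewrite updateE; case: eqP => //; lia.
    * by move=> a na /=; rewrite updateE; case: eqP => [|_]; [lia|apply: so2].
    * by move=> z; rewrite updateE; case: eqP => [|_]; [have := ltn_ord z; lia|].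
    * move=> z; rewrite updateE eqn_add2l; case: eqP => [zi|ne].
        have -> : z = v by apply: val_inj.
        by rewrite /= ltnSn /reach big_cons -/(reach U v); apply/esym/maxn_idPl; lia.
      by rewrite re2; have -> : (z < i.+1) = (z < i) by lia.
  + split=> //; split=> // z; rewrite re2.
    have [zi|ne] := eqVneq (nat_of_ord z) i; last first.
      by have -> : (z < i.+1) = (z < i) by lia.
    have -> : z = v by apply: val_inj.
    by rewrite /= ltnSn ltnn /reach big_cons -/(reach U v); apply/esym/maxn_idPr; lia.
- move=> s2 w2 bs2 fr2 [-> [en2 so2 di2 re2]]; split=> // v.
  by rewrite re2 ltn_ord.
Qed.

Definition candidate (s : state) (U : seq 'I_n) (x : 'I_n) :=
  [/\ env s, covered s U, vars s 13 = x, vars s 0 = reach U x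
    & forall v, reach U x <= reach U v].

Definition argmin_time : nat := cmd_weight argmin_start + (6 + n * (cmd_weight argmin_body + 10)).

Lemma hoare_argmin s w U : 0 < n -> env s -> covered s U ->
  hoare argmin s w argmin_time (fun s' w' => w' = w /\ exists x, candidate s' U x).
Proof.
move=> n0 en cov; apply: hoare_seq (leqnn _).
pose x0 := Ordinal n0.
have E0 : memory s (work + 2 * n) = reach U x0 by rewrite -cov /= addn0.
have rl := reach_le U x0.
apply: hoare_wp => //=; rewrite ?updateE /= (env5 en) E0.
split_and => //; first by rewrite /max_value; lia.
set s1 := set_var _ 21 0.
pose I i s' := exists x : 'I_n, [/\ env s', covered s' U, vars s' 13 = x, vars s' 0 = reach U x
   & forall v : 'I_n, v < i -> reach U x <= reach U v].
have := @hoare_upto max_value max_value_ge2 21 1 argmin_body s1 w n I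
  (fun=> cmd_weight argmin_body).
rewrite sum_nat_const_nat subn0 => H.
apply: hoare_weaken (H _ _ _ _ _ _ _ _) _ _ => //.
- exact: env1 en.
- exists x0; split=> //; apply: env_vars en _ _ => //; frame_vars.
- move=> i s2 [x [en2 cov2 v13 v0 mi]]; exists x; split=> //.
  apply: env_vars en2 _ _ => //; frame_vars.
- move=> i s2 lti bs2 v21 _ [x [en2 cov2 v13 v0 mi]].
  apply: hoare_wp => //.
  pose v := Ordinal lti; have rv := reach_le U v.
  have mv (z : 'I_n) : z < i.+1 -> z < i \/ z = v.
    by rewrite ltnS leq_eqVlt => /orP[/eqP zi|]; [right; apply: val_inj | left].
  rewrite /= (env5 en2) v21 v0 (cov2 v); case: ifP => cmp /=.
  + rewrite ?updateE /= v21; split_and => //; try by rewrite /max_value; lia.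
    exists v; split=> //.
    * apply: env_vars en2 _ _ => //; frame_vars.
    * move=> z lz; have [/mi|->] := mv z lz; by lia.
  + split=> //; exists x; split=> // z lz; have [/mi|->] := mv z lz; by lia.
- move=> s2 w2 bs2 fr2 [-> [x [en2 cov2 v13 v0 mi]]]; split=> //; exists x; split=> // v.
  exact: mi.
Qed.


(** As [reach] exceeds the largest distance to a source by one, these are the vertices strictly
    farther from [x] than all sources; in particular none of them is a source. *)
Definition far (U : seq 'I_n) (x : 'I_n) : {set 'I_n} := [set v | reach U x <= dist e x v].

Definition round_time (f : nat) : nat :=
  10 + bfs_time + (6 + n * (cmd_weight copy_body + 10))
  + (6 + (n * (cmd_weight far_body + 10) + f * add_time)) + argmin_time.

Lemma hoare_far_body s w U U' (x : 'I_n) i (lti : i < n) :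
  env s -> covered s U' -> vars s 14 = i -> vars s 0 = reach U x ->
  (forall v : 'I_n, memory s (work + 3 * n + v) = (dist e x v).+1) ->
  hoare far_body s w (cmd_weight far_body + (Ordinal lti \in far U x) * add_time)
   (fun s' w' => [/\ w' = w, env s',
      (forall v : 'I_n, memory s' (work + 3 * n + v) = (dist e x v).+1) &
      if Ordinal lti \in far U x then covered s' (Ordinal lti :: U') /\ vars s' 12 = 1
      else covered s' U' /\ vars s' 12 = vars s 12]).
Proof.
move=> en cov v14 v0 di; set v := Ordinal lti.
have wE : cmd_weight far_body = 8 + (4 + cmd_weight add_source) by [].
apply: (hoare_if max_value_ge2 (T := 3 + (v \in far U x) * add_time)).
- rewrite /= (env6 en) v14 (di v) v0 inE.
  case: ifP => cmp; last first.
    apply: hoare_wp_le => //=.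
    by have -> : (reach U x <= dist e x v) = false by lia.
  have -> : (reach U x <= dist e x v) = true by lia.
  rewrite mul1n; apply: hoare_seq (leqnn _).
  apply: hoare_wp_le => //=.
  rewrite ?updateE /= v14; split_and; try by rewrite /max_value; lia.
  set s1 := set_var _ 10 _.
  apply: hoare_weaken (@hoare_add_source s1 w U' v _ _ _) (leqnn _) _ => //.
  + apply: env_vars en _ _ => //; frame_vars.
  + move=> s2 _ bs2 fr2 [-> en2 cov2 so2]; split=> //; last first.
      by split=> //; rewrite fr2.
    by move=> z; rewrite so2 ?di //; have := ltn_ord z; lia.
- by rewrite wE; change (weight _) with 8; lia.
Qed.

(** Until the final [argmin], variable 0 keeps [reach U x] and the array at the address in variable
    6 keeps the distances from [x], so the searches made meanwhile do not affect which vertices are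
    added. *)
Lemma hoare_round s w U (x : 'I_n) i : candidate s U x -> vars s 11 = i ->
  hoare round s w (round_time #|far U x|) (fun s' w' => w' = w /\ exists U' x',
    [/\ candidate s' U' x', vars s' 11 = i.-1,
      (forall b, (b \in U') = (b \in U) || (b \in far U x))
      & vars s' 12 = 0 -> far U x = set0]).
Proof.
move=> [en cov v13 v0 mi] v11; have n0 := leq_ltn_trans (leq0n _) (ltn_ord x).
rewrite /round_time.
pose t3 := 6 + (n * (cmd_weight far_body + 10) + #|far U x| * add_time).
pose t2 := 6 + n * (cmd_weight copy_body + 10).
apply: (@hoare_seq _ _ _ _ _ 2 (bfs_time + (1 + (t2 + (1 + (t3 + (argmin_time + 6))))))); last first.
  by rewrite /t2 /t3; lia.
apply: (@hoare_wp max_value max_value_ge2 (Seq _ _)) => /=.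
rewrite ?updateE /= v13; split_and => //; first by rewrite /max_value; have := ltn_ord x; lia.
set s1 := set_var _ 10 _.
have en1 : env s1 by apply: env_vars en _ _ => //; frame_vars.
apply: hoare_seq (leqnn _).
apply: hoare_weaken (@hoare_bfs x s1 w en1 (erefl _)) (leqnn _) _.
move=> s2 _ bs2 fr2 [-> di2 so2]; apply: hoare_seq (leqnn _).
apply: (@hoare_wp max_value max_value_ge2 (Assign _ _)) => /=; split=> //.
have en2 : env s2.
  apply: env_frame en1 _ _ => [y ly|a la]; last by apply: so2; lia.
  by apply: fr2; case: y ly => [|[|[|[|[|[|[|y]]]]]]].
have cov2 : covered s2 U.
  by move=> v; rewrite so2 /= ?cov //; lia.
have v02 : vars s2 0 = reach U x by rewrite fr2.
have v112 : vars s2 11 = i by rewrite fr2.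
have v122 : vars s2 12 = 0 by rewrite fr2.
clear en1 so2 fr2; apply: hoare_seq (leqnn _).
pose I i s' := [/\ env s', covered s' U,
  (forall v : 'I_n, memory s' (work + v) = (dist e x v).+1)
  & forall v : 'I_n, v < i -> memory s' (work + 3 * n + v) = (dist e x v).+1].
have := @hoare_upto max_value max_value_ge2 21 1 copy_body (set_var s2 21 0) w n I
  (fun=> cmd_weight copy_body).
rewrite sum_nat_const_nat subn0 => H.
apply: hoare_weaken (H _ _ _ _ _ _ _ _) (leqnn _) _ => //.
- exact: env1 en2.
- split=> //; apply: env_vars en2 _ _ => //; frame_vars.
- move=> j s3 [en3 cov3 di3 cp3]; split=> //; apply: env_vars en3 _ _ => //; frame_vars.
- move=> j s3 ltj bs3 v21 _ [en3 cov3 di3 cp3].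
  apply: hoare_wp => //.
  pose v := Ordinal ltj.
  have ltd := dist_lt_card e_conn x v; rewrite card_ord in ltd.
  rewrite /= (env3 en3) (env6 en3) v21 (di3 v).
  split; first by rewrite /max_value; lia.
  split=> //; split=> /=.
  + by apply: env_frame en3 _ _ => //= a la; rewrite updateE; case: eqP => //; lia.
  + by move=> z /=; rewrite updateE; case: eqP => [|_]; [have := ltn_ord z; lia|rewrite cov3].
  + by move=> z; rewrite updateE; case: eqP => [|_]; [have := ltn_ord z; lia|].
  + move=> z lz; rewrite updateE eqn_add2l; case: eqP => [zi|ne].
      by have -> : z = v by apply: val_inj.
    by apply: cp3; lia.
move=> s3 _ bs3 fr3 [-> [en3 cov3 _ di3]].
have {}di3 (v : 'I_n) := di3 v (ltn_ord v).
have v03 : vars s3 0 = reach U x by rewrite fr3.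
have v113 : vars s3 11 = i by rewrite fr3.
have v123 : vars s3 12 = 0 by rewrite fr3.
clear H I fr3; apply: hoare_seq (leqnn _).
apply: (@hoare_wp max_value max_value_ge2 (Assign _ _)) => /=; split=> //.
apply: hoare_seq (leqnn _).
pose I j s' := exists U', [/\ env s', covered s' U', vars s' 0 = reach U x,
  (forall v : 'I_n, memory s' (work + 3 * n + v) = (dist e x v).+1) &
  [/\ vars s' 11 = i, (forall b : 'I_n, (b \in U') = (b \in U) || (b \in far U x) && (b < j))
  & vars s' 12 = 0 -> forall b : 'I_n, b < j -> b \notin far U x]].
(* A pass pays for a search only if its vertex is far; [insubd] reads the counter as a vertex, and
   summing over the passes yields [#|far U x|] searches. *)
have := @hoare_upto max_value max_value_ge2 14 1 far_body (set_var s3 14 0) w n I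
  (fun j => cmd_weight far_body + (insubd x j \in far U x) * add_time).
set S := \sum_(_ <= _ < _) _.
have -> : S = n * (cmd_weight far_body + 10) + #|far U x| * add_time.
  rewrite /S /= big_mkord -sum1_card big_distrl /= [X in _ = _ + X]big_mkcond.
  have -> : n * (cmd_weight far_body + 10) = \sum_(v < n) (cmd_weight far_body + 10).
    by rewrite sum_nat_const card_ord.
  rewrite -big_split /=.
  by apply: eq_bigr => v _; rewrite valKd addnAC; case: (v \in far U x).
move=> H.
apply: hoare_weaken (H _ _ _ _ _ _ _ _) (leqnn _) _ => //.
- exact: env1 en3.
- exists U; split=> //; first by apply: env_vars en3 _ _ => //; frame_vars.
  by split=> // b; rewrite andbF orbF.
- move=> j s4 [U' [en4 cov4 v04 di4 [v114 mem4 z4]]]; exists U'; split=> //.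
  by apply: env_vars en4 _ _ => //; frame_vars.
- move=> j s4 ltj bs4 v14 _ [U' [en4 cov4 v04 di4 [v114 mem4 z4]]].
  have vE : insubd x j = Ordinal ltj by apply: val_inj; rewrite val_insubd ltj.
  rewrite vE; apply: hoare_weaken (@hoare_far_body s4 w U U' x j ltj en4 cov4 v14 v04 di4) (leqnn _) _.
  set v := Ordinal ltj.
  have ltS (b : 'I_n) : (b < j.+1) = (b == v) || (b < j) by rewrite ltnS leq_eqVlt.
  move=> s5 _ bs5 fr5 [-> en5 di5]; case: ifP => vf [cov5 v12].
  + split=> //; exists (v :: U'); split=> //; first by rewrite fr5.
    split=> //; [by rewrite fr5 | | by rewrite v12].
    move=> b; rewrite inE mem4 ltS; case: eqP => [->|_] //=.
    by rewrite vf orbT.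
  + split=> //; exists U'; split=> //; first by rewrite fr5.
    split=> //; first by rewrite fr5.
    - by move=> b; rewrite mem4 ltS; case: eqP => [->|_] //=; rewrite vf.
    - move=> e0 b; rewrite ltS => /orP[/eqP->|]; first by rewrite vf.
      by apply: z4; rewrite -v12.
move=> s4 _ bs4 fr4 [-> [U' [en4 cov4 v04 di4 [v114 mem4 z4]]]].
apply: hoare_seq (leqnn _).
apply: hoare_weaken (@hoare_argmin s4 w U' n0 en4 cov4) (leqnn _) _.
move=> s5 _ bs5 fr5 [-> [x' [en5 cov5 v135 v05 mi5]]].
apply: hoare_wp_le => //=.
have v115 : vars s5 11 = i by rewrite fr5.
split; first by apply: leq_trans (leq_subr _ _) _; case: bs5.
split=> //; exists U', x'; split=> //.
- by split=> //; apply: env_vars en5 _ _ => //; frame_vars.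
- by rewrite /= updateE /= v115 subn1.
- by move=> b; rewrite mem4 ltn_ord andbT.
- rewrite /= updateE /= fr5 // => /z4 nf; apply/setP => b; rewrite in_set0.
  by apply/negbTE/nf.
Qed.


(** * Drawing random vertices *)

Definition bits_val : nat -> seq bool -> nat := foldl (fun a (b : bool) => 2 * a + b).

Section Sampling.
Variables (L st : nat).
Hypotheses (n_gt0 : 0 < n) (L_ge : n <= 2 ^ L) (L_min : forall j, j < L -> 2 ^ j < n).
Hypotheses (st_ge : kk * n <= st * st) (st_min : forall j, j < st -> j * j < kk * n).

Definition vertex_of_bits (bs : seq bool) : 'I_n := Ordinal (ltn_pmod (bits_val 0 bs) n_gt0).

Definition sample_time : nat := 20 + L * (cmd_weight toss_body + 4).

Lemma hoare_sample s bs w : env s -> size bs = L ->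
  hoare sample s (bs ++ w) sample_time (fun s' w' =>
    [/\ w' = w, memory s' = memory s & vars s' 10 = vertex_of_bits bs]).
Proof.
move=> en sbs.
apply: (@hoare_seq _ _ _ _ _ 3 (4 + L * (cmd_weight toss_body + 4) + 13)); last first.
  by rewrite /sample_time; lia.
apply: (@hoare_wp max_value max_value_ge2 (Seq _ _)) => /=.
split_and => //; first by rewrite /max_value; lia.
set s1 := set_var _ 8 _; apply: hoare_seq (leqnn _).
(* [bs2] are the coins of this sample still to be read; variable 8 is the power of two that bounds
   the number spelled so far. *)
apply: (hoare_while max_value_ge2 (I := fun s' w' T => exists bs2,
  [/\ w' = bs2 ++ w, memory s' = memory s, vars s' 1 = n &
  [/\ vars s' 8 * 2 ^ size bs2 = 2 ^ L, vars s' 10 < vars s' 8,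
    bits_val (vars s' 10) bs2 = bits_val 0 bs
  & T = 4 + size bs2 * (cmd_weight toss_body + 4)]])).
- by exists bs; rewrite /= ?updateE /= (env1 en) mul1n sbs.
- move=> s2 w2 T bs2 [bs' [-> me2 v1 [v8 v10 bv ->]]] /=; rewrite v1 => e0.
  split; first exact: leq_addr.
  (* The loop cannot stop early: with coins left, variable 8 is [2 ^ j] for some [j < L], which is
     below [n] by minimality of [L]. *)
  have bs'0 : bs' = [::].
    case: bs' bv v8 => // b bs' _ v8.
    have ltL : size bs' < L.
      rewrite -(ltn_exp2l _ _ (isT : 1 < 2)) -v8 /= expnS.
      by have := expn_gt0 2 (size bs'); nia.
    have lt := @L_min (L - (size bs').+1) _.
    have : vars s2 8 = 2 ^ (L - (size bs').+1).
      by rewrite expnB // -v8 mulnK // expn_gt0.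
    by move=> v8E; have := lt ltac:(lia); lia.
  subst bs'; rewrite /= in bv.
  apply: hoare_wp_le => //=.
  rewrite v1 bv; have dE := divn_eq (bits_val 0 bs) n.
  have le : vars s2 10 <= max_value by case: bs2.
  split; first by rewrite bv in le; apply: leq_trans (leq_subr _ _) le.
  by split=> //=; rewrite updateE /= {1}dE addKn.
- move=> s2 w2 T bs2 [[|b bs'] [-> me2 v1 [v8 v10 bv ->]]] /=; rewrite v1 => e0.
    by rewrite /= muln1 in v8; lia.
  exists (cmd_weight toss_body), (4 + size bs' * (cmd_weight toss_body + 4)); split.
    by change (weight _) with 4; lia.
  apply: (@hoare_seq _ _ _ _ _ 1 22) => //; apply: hoare_toss => //.
  apply: hoare_wp_le => //=; rewrite ?updateE /=.
  have b1 := leq_b1 b; split_and; try by rewrite /max_value; lia.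
  exists bs'; split=> //; rewrite /= ?updateE //=; split=> //.
  + by rewrite -v8 /= expnS; lia.
  + by lia.
Qed.

Fixpoint drawn (j : nat) (w : seq bool) : seq 'I_n :=
  if j is j'.+1 then vertex_of_bits (take L (drop (j' * L) w)) :: drawn j' w else [::].

Definition sampling_time : nat := 12 + st * (18 + sample_time + add_time).

Lemma hoare_sampling s w : env s -> covered s [::] -> vars s 7 = 0 -> st * L <= size w ->
  hoare sampling s w sampling_time (fun s' w' =>
    [/\ w' = drop (st * L) w, env s' & covered s' (drawn st w)]).
Proof.
move=> en cov v7 sw.
(* [n] samples pass the stopping test because [kk <= n]; this keeps the sample counter below
   [max_value]. *)
have st_le : st <= n.
  by rewrite leqNgt; apply/negP => /st_min; rewrite ltnNge leq_mul2r kk_le orbT.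
apply: (hoare_while max_value_ge2 (I := fun s' w' T => exists j,
  [/\ w' = drop (j * L) w, env s', covered s' (drawn j w), vars s' 7 = j
    & j <= st /\ T = 12 + (st - j) * (18 + sample_time + add_time)])).
- by exists 0; rewrite drop0 subn0.
- move=> s1 _ T bs1 [j [-> en1 cov1 v71 [le ->]]] /=; rewrite (env1 en1) (env2 en1) v71 => e0.
  split; first exact: leq_addr.
  have -> : st = j; last by [].
  apply/eqP; rewrite eqn_leq le andbT leqNgt; apply/negP => /st_min; lia.
- move=> s1 _ T bs1 [j [-> en1 cov1 v71 [le ->]]] /=; rewrite (env1 en1) (env2 en1) v71 => e0.
  have ltj : j < st.
    rewrite ltn_neqAle le andbT; apply/eqP => ej; subst j; lia.
  exists (6 + (sample_time + add_time)), (12 + (st - j.+1) * (18 + sample_time + add_time)); split.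
    change (weight _) with 12; have -> : st - j = (st - j.+1).+1 by lia.
    by rewrite mulSn; lia.
  apply: hoare_seq (leqnn _).
  apply: (@hoare_wp max_value max_value_ge2 (Assign _ _)) => /=; rewrite v71.
  split; first by rewrite /max_value; lia.
  set s2 := set_var _ 7 _.
  have en2 : env s2 by apply: env_vars en1 _ _ => //; frame_vars.
  have sz : size (take L (drop (j * L) w)) = L.
    rewrite size_takel // size_drop; have := leq_mul2r L j.+1 st; rewrite ltj orbT mulSn; lia.
  apply: hoare_seq (leqnn _).
  rewrite -{1}[drop (j * L) w](cat_take_drop L).
  apply: hoare_weaken (hoare_sample (drop L (drop (j * L) w)) en2 sz) (leqnn _) _.
  move=> s3 _ bs3 fr3 [-> me3 v10].
  have en3 : env s3.
    apply: env_vars en2 me3 _ => x lx.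
    by apply: fr3; case: x lx => [|[|[|[|[|[|[|x]]]]]]].
  have cov3 : covered s3 (drawn j w) by move=> v; rewrite me3 /= cov1.
  apply: hoare_weaken (hoare_add_source (drop L (drop (j * L) w)) en3 v10 cov3) (leqnn _) _.
  move=> s4 _ bs4 fr4 [-> en4 cov4 _]; exists j.+1; split=> //.
  + by rewrite drop_drop mulSn.
  + by rewrite fr4 // fr3 //= addn1.
Qed.

End Sampling.

(** * Deterministic analysis of the rounds, given sources that meet all large sets *)

Section Rounds.
Variables (k alpha q : nat) (U0 : seq 'I_n).
Hypotheses (n_gt1 : 1 < n) (kkE : kk = minn k n) (e_helly : helly e k alpha).
Hypothesis U0_hits : forall x t, q < #|[set v | t <= dist e x v]| ->
  exists2 u, u \in U0 & t <= dist e x u.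

Lemma reach_ge U u v : u \in U -> dist e u v < reach U v.
Proof. by move=> uU; apply: (leq_bigmax_seq (F := fun u => (dist e u v).+1)). Qed.

(** The sources are only some of the vertices, so [(reach U v).-1] is at most the eccentricity of
    every [v]; minimality of [x] carries this to the radius. *)
Lemma radius_ge U x : (forall v, reach U x <= reach U v) -> (reach U x).-1 <= radius e.
Proof.
move=> mi; rewrite /radius; elim/big_ind: _ => [|a b ha hb|v _].
- by rewrite card_ord; have := reach_le U x; lia.
- by rewrite leq_min ha.
- have : reach U v <= (\max_u dist e u v).+1.
    by apply/bigmax_leqP_seq => u _ _; rewrite ltnS (leq_bigmax (F := fun u => dist e u v)).
  by have := mi v; lia.
Qed.

Lemma radius_le x r : (forall v, dist e x v <= r) -> radius e <= r.
Proof.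
move=> le; suff ecc_x : radius e <= \max_u dist e u x.
  by apply: leq_trans ecc_x _; apply/bigmax_leqP => v _; rewrite dist_sym.
pose F v := \max_u dist e u v.
suff le_F l : x \in l -> \big[minn/#|'I_n|]_(v <- l) F v <= F x.
  by apply: le_F; apply: mem_index_enum.
elim: l => // y l IH; rewrite inE big_cons geq_min => /orP[/eqP<-|/IH->]; first by rewrite leqnn.
by rewrite orbT.
Qed.

(* Each round that searches moves an element of every witness [B] into the set
   of sources, so after [kk] rounds there is no witness left. *)
Definition few_unseen (U : seq 'I_n) (r i : nat) : Prop :=
  forall (B : {set 'I_n}) r', r <= r' -> #|B| <= kk ->
    (forall y, exists2 b, b \in B & r' <= dist e y b) ->
    #|[set b in B | b \notin U]| <= i.

(** Apply the Helly property to the balls of radius [(reach U x).-1] around all vertices. The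
    centres of at most [k] such balls without common point would form a witness, hence all lie in
    [U]; but [x] is within that radius of every element of [U]. *)
Lemma radius_le_helly U x :
  few_unseen U (reach U x) 0 -> radius e <= (reach U x).-1 + alpha.
Proof.
move=> fu.
have [] := @e_helly n id (fun=> (reach U x).-1) n_gt1 _; last first.
  by move=> z le; apply: (radius_le le).
move=> J cJ; apply/negP => /eqP J0.
have bad y : exists2 b, b \in J & reach U x <= dist e y b.
  have [b /andP[bJ lb]|nb] := pickP (fun b => (b \in J) && (reach U x <= dist e y b)).
    by exists b.
  have : y \in \bigcap_(i in J) ball e i (reach U x).-1; last by rewrite J0 inE.
  by apply/bigcapP => b bJ; have := nb b; rewrite inE bJ /=; lia.
have cJ' : #|J| <= kk by rewrite kkE leq_min cJ -[X in _ <= X]card_ord max_card.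
have := fu J _ (leqnn _) cJ' bad; rewrite leqn0 cards_eq0 => /eqP JU.
have [b bJ le] := bad x.
have bU : b \in U.
  apply/negPn/negP => nb; have : b \in [set b in J | b \notin U] by rewrite inE bJ.
  by rewrite JU inE.
by have := reach_ge x bU; rewrite dist_sym //; lia.
Qed.

(** The minimum of [reach] never decreases, so a witness for the new threshold is one for the old;
    this is why [few_unseen] ranges over all [r' >= r]. Some element of the witness is at distance
    at least [reach U x] from [x]: it is not in [U], and the round adds it. *)
Lemma few_unseenS U U' x x' i : few_unseen U (reach U x) i ->
  reach U x <= reach U' x' ->
  (forall b, (b \in U') = (b \in U) || (b \in far U x)) ->
  few_unseen U' (reach U' x') i.-1.
Proof.
move=> fu le mem' B r' ler cB bad.
have {}ler := leq_trans le ler; have := fu B r' ler cB bad.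
have [b bB lb] := bad x.
have bf : b \in far U x by rewrite inE (leq_trans ler).
have bU : b \notin U.
  by apply/negP => /(reach_ge x); rewrite dist_sym //; lia.
have lt : #|[set b in B | b \notin U']| < #|[set b in B | b \notin U]|.
  apply: proper_card; apply/properP; split.
    by apply/subsetP => z; rewrite !inE mem' negb_or => /and3P[-> ->].
  by exists b; rewrite !inE bB // mem' bf orbT.
by lia.
Qed.

Lemma reach_sub U U' v : {subset U <= U'} -> reach U v <= reach U' v.
Proof.
move=> sub; apply/bigmax_leqP_seq => u uU _; exact: reach_ge (sub _ uU).
Qed.

Definition rounds_time : nat := argmin_time + 13 + kk * (4 + round_time q).

Lemma hoare_rounds s w : env s -> covered s U0 ->
  hoare rounds s w rounds_time (fun s' _ =>
    vars s' 0 <= radius e /\ radius e <= vars s' 0 + alpha).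
Proof.
move=> en cov.
apply: (@hoare_seq _ _ _ _ _ argmin_time (3 + ((4 + kk * (4 + round_time q)) + 6))); last first.
  by rewrite /rounds_time; lia.
apply: hoare_weaken (hoare_argmin w (ltnW n_gt1) en cov) (leqnn _) _.
move=> s1 _ bs1 fr1 [-> [x1 [en1 cov1 v131 v01 mi1]]].
apply: hoare_seq (leqnn _).
apply: (@hoare_wp max_value max_value_ge2 (Seq _ _)) => /=.
rewrite ?updateE /= (env2 en1); split_and; try by rewrite /max_value; lia.
set s2 := set_var _ 11 _; apply: hoare_seq (leqnn _).
(* There are two ways to stop. With no rounds left, [few_unseen] at 0 brings in the Helly property;
   if the last round made no search, its candidate is the [y] whose eccentricity is below
   [reach U x]. *)
apply: (hoare_while max_value_ge2 (I := fun s' _ T => exists U x i,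
  [/\ candidate s' U x, vars s' 11 = i, {subset U0 <= U}, T = 4 + i * (4 + round_time q)
    & few_unseen U (reach U x) i /\
      (vars s' 12 = 0 -> exists y, forall v, dist e y v < reach U x)])).
- exists U0, x1, kk; split=> //.
    by split=> //; apply: env_vars en1 _ _ => //; frame_vars.
  split=> // B r' _ cB _; apply: leq_trans cB; apply: subset_leq_card.
  by apply/subsetP => b; rewrite inE => /andP[].
- move=> s3 w3 T bs3 [U [x [i [[en3 cov3 v133 v03 mi3] v11 sub -> [fu done]]]]] /= e0.
  split; first exact: leq_addr.
  apply: hoare_wp_le => //=; rewrite v03 subn1.
  split; first by rewrite /max_value; have := reach_le U x; lia.
  split; first exact: radius_ge.
  rewrite updateE /=; move/eqP: e0; rewrite muln_eq0 => /orP[/eqP/done[y le]|/eqP i0].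
    apply: leq_trans (leq_addr _ _); apply: (radius_le (x := y)) => v.
    by have := le v; lia.
  by apply: radius_le_helly; rewrite -i0 v11.
- move=> s3 w3 T bs3 [U [x [i [cand3 v11 sub -> [fu done]]]]] /= e0.
  have i0 : 0 < i by rewrite -v11; case: (vars s3 11) e0 => //; rewrite muln0.
  exists (round_time q), (4 + i.-1 * (4 + round_time q)); split.
    by change (weight _) with 4; rewrite -{2}(prednK i0) mulSn; lia.
  apply: hoare_weaken (hoare_round w3 cand3 v11) _ _.
    (* No source is far, so the far set avoids [U0] and cannot be large. *)
    have : #|far U x| <= q.
      rewrite leqNgt; apply/negP => /U0_hits[u /sub uU le].
      by have := reach_ge x uU; rewrite dist_sym //; lia.
    by rewrite /round_time => lf; rewrite leq_add2r !leq_add2l leq_mul2r lf orbT.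
  move=> s4 w4 bs4 fr4 [_ [U' [x' [cand4 v114 mem' z4]]]].
  have sub' : {subset U <= U'} by move=> b bU; rewrite mem' bU.
  have le : reach U x <= reach U' x'.
    apply: leq_trans (reach_sub x' sub').
    by case: cand3.
  exists U', x', i.-1; split=> //; first by move=> b /sub /sub'.
  split; first exact: few_unseenS mem'.
  move=> /z4 f0; exists x => v; apply: leq_trans le; rewrite ltnNge.
  by apply/negP => lv; have : v \in far U x by [rewrite inE]; rewrite f0 inE.
Qed.

End Rounds.
End Program.


(** * The encoded input and the run of the whole program *)

Section Input.
Variables (n k : nat) (adj : 'I_n -> seq 'I_n).
Local Notation offset := (offset adj).
Local Notation input := (graph_input adj k).

Lemma offset0 : offset 0 = 0.
Proof. by rewrite /offset big1. Qed.

Lemma sumn_take_shape i : i <= n ->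
  sumn (take i (shape [seq map val (adj u) | u <- enum 'I_n])) = offset i.
Proof.
elim: i => [|i IH] lei; first by rewrite take0 offset0.
rewrite (take_nth 0); last by rewrite /shape 2!size_map size_enum_ord.
rewrite sumn_rcons IH; last exact: ltnW.
rewrite (offsetS adj (Ordinal lei)) /=; congr (_ + _).
rewrite (nth_map [::]); last by rewrite size_map size_enum_ord.
rewrite (nth_map (Ordinal lei)) ?size_enum_ord // size_map.
by congr (size (adj _)); apply: val_inj; rewrite /= nth_enum_ord.
Qed.

Lemma size_flatten_adj : size (flatten [seq map val (adj u) | u <- enum 'I_n]) = offset n.
Proof.
rewrite size_flatten -(sumn_take_shape (leqnn n)) take_oversize //.
by rewrite /shape 2!size_map size_enum_ord.
Qed.

Lemma size_input : size input = work adj.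
Proof.
by rewrite /graph_input /= size_cat size_map size_iota size_flatten_adj /work; lia.
Qed.

Lemma nth_inputSS a : nth 0 input a.+2 =
  nth 0 ([seq offset i | i <- iota 0 n.+1] ++ flatten [seq map val (adj u) | u <- enum 'I_n]) a.
Proof. by []. Qed.

Lemma nth_input_offset i : i <= n -> nth 0 input (2 + i) = offset i.
Proof.
move=> lei; rewrite add2n nth_inputSS nth_cat size_map size_iota ltnS lei.
by rewrite (nth_map 0) ?size_iota // nth_iota.
Qed.

Lemma nth_input_adj (u x0 : 'I_n) j : j < size (adj u) ->
  nth 0 input (n + 3 + (offset u + j)) = nth x0 (adj u) j.
Proof.
move=> ltj.
have -> : n + 3 + (offset u + j) = (n.+1 + (offset u + j)).+2 by lia.
rewrite nth_inputSS nth_cat size_map size_iota ltnNge leq_addr /= addKn.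
have szu : u < size [seq map val (adj v) | v <- enum 'I_n] by rewrite size_map size_enum_ord.
rewrite -(cat_take_drop u [seq map val (adj v) | v <- enum 'I_n]) flatten_cat nth_cat.
rewrite size_flatten.
have -> : sumn (shape (take u [seq map val (adj v) | v <- enum 'I_n])) = offset u.
  by rewrite /shape map_take sumn_take_shape // ltnW.
rewrite ltnNge leq_addr /= addKn (drop_nth [::]) //= nth_cat.
rewrite (nth_map u) ?size_enum_ord // nth_ord_enum size_map ltj.
by rewrite (nth_map x0).
Qed.

(** Cell 1 is excluded because it holds [k], which no function of [n] bounds. *)
Lemma nth_input_le a : a != 1 -> nth 0 input a <= max_value adj.
Proof.
case: a => [|[|a]] // _; first by rewrite /= /max_value; lia.
rewrite nth_inputSS nth_cat size_map size_iota; case: ltnP => ale.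
  rewrite (nth_map 0) ?size_iota // nth_iota //.
  by rewrite /max_value /work; have := offset_le adj (0 + a); lia.
have [lt|ge] := ltnP (a - n.+1) (size (flatten [seq map val (adj u) | u <- enum 'I_n])).
  have /flattenP[l /mapP[u _ ->] /mapP[v _ ->]] := mem_nth 0 lt.
  by rewrite /max_value; have := ltn_ord v; rewrite /=; lia.
by rewrite nth_default.
Qed.

End Input.

Section Run.
Variables (n k alpha : nat) (e : rel 'I_n) (adj : 'I_n -> seq 'I_n).
Hypotheses (n_gt1 : 1 < n) (e_sym : symmetric e) (e_conn : connected_graph e).
Hypotheses (adjP : adjacency_lists e adj) (e_helly : helly e k alpha).
Let kk := minn k n.
Local Notation input := (graph_input adj k).
Local Notation M := (max_value adj).

(** Counted directly from [exec]: while [k] is in memory the state may fail to be [bounded], so the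
    program logic takes over only afterwards. *)
Lemma exec_cap_k w : exists s t,
  [/\ exec cap_k (init input) w s w t, t <= 2 * bit_length k + 10 * bit_length M,
      bounded M s, vars s =1 (fun=> 0)
    & forall a, memory s a = if a == 1 then kk else nth 0 input a].
Proof.
have le0 := @nth_input_le n k adj.
have nM : bit_length n <= bit_length M by apply: bit_length_mono; rewrite /max_value /work; lia.
have kM : bit_length (k - n) <= bit_length k by apply: bit_length_mono; lia.
have b1 : bit_length 1 = 1 by [].
have b0 : bit_length 0 = 1 by rewrite /bit_length trunc_log0.
have Mpos : 0 < bit_length M by [].
have [kn|kn] := leqP k n.
  exists (init input); eexists; split.
  - apply: ExecIf => /=; have -> : k - n = 0 by lia.
    exact: ExecSkip.
  - by rewrite /= b1 b0; lia.
  - split=> //= a; have [->|] := eqVneq a 1; last exact: le0.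
    by rewrite /= /max_value /work; lia.
  - by [].
  - by move=> a /=; case: eqP => // ->; rewrite /kk /=; lia.
exists (set_mem (init input) 1 n); eexists; split.
- apply: ExecIf => /=; have -> : (k - n != 0) = true by lia.
  exact: ExecStore.
- by rewrite /= b1 b0; lia.
- split=> //= a; rewrite updateE; case: eqP => [_|/eqP]; last exact: le0.
  by rewrite /max_value /work; lia.
- by [].
- by move=> a /=; rewrite updateE; case: eqP => // _; rewrite /kk; lia.
Qed.

Variables (L st q : nat).
Hypotheses (L_ge : n <= 2 ^ L) (L_min : forall j, j < L -> 2 ^ j < n).
Hypotheses (st_ge : kk * n <= st * st) (st_min : forall j, j < st -> j * j < kk * n).

Definition total_time : nat :=
  2 * bit_length k
  + (10 + cmd_weight setup + sampling_time adj L st + rounds_time kk adj q) * bit_length M.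

Lemma exec_radius_cmd (w : seq bool) : st * L <= size w ->
  (forall x t, q < #|[set v | t <= dist e x v]| ->
     exists2 u, u \in drawn L (ltnW n_gt1) st w & t <= dist e x u) ->
  halts_within total_time radius_cmd input
    (fun r => r <= radius e /\ radius e <= r + alpha) w.
Proof.
move=> sw hits.
have [s1 [t1 [ex1 le1 bs1 v1 m1]]] := exec_cap_k w.
have kk_le : kk <= n by rewrite /kk geq_minr.
have M2 := max_value_ge2 adj.
suff [] : hoare M (Seq setup (Seq sampling rounds)) s1 w
    (cmd_weight setup + (sampling_time adj L st + rounds_time kk adj q))
    (fun s' _ => vars s' 0 <= radius e /\ radius e <= vars s' 0 + alpha).
- by [].
- move=> s2 [w2 [t2 [ex2 le2 bs2 Q2]]].
  exists s2, w2, (t1 + t2); split=> //; first exact: ExecSeq ex1 ex2.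
  by rewrite /total_time; move: le1 le2; set B := bit_length M; nia.
apply: hoare_seq (leqnn _); apply: (hoare_wp M2) => /=.
rewrite /update /= !m1 /=.
rewrite (_ : nth 0 _ n = offset adj n); last first.
  by have := @nth_input_offset n k adj n (leqnn n).
rewrite -/(work adj).
split_and; try by rewrite /max_value /work; lia.
set s2 := set_var _ 6 _.
have en2 : env kk adj s2.
  split=> //=.
  - by rewrite /update /=; lia.
  - by rewrite /update /=; lia.
  - by move=> i lei; rewrite m1 nth_input_offset.
  - move=> u x0 j ltj; rewrite m1 -(nth_input_adj k _ ltj).
    by case: eqP => // ; lia.
have cov2 : covered e adj s2 [::].
  move=> v; rewrite /= m1 /reach big_nil; case: eqP => [|_]; first by rewrite /work; lia.
  by rewrite nth_default // -[X in _ <= X]/(_ + _ + _) size_input; lia.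
have v72 : vars s2 7 = 0 by rewrite /= /update /= v1.
apply: hoare_seq (leqnn _).
have H := hoare_sampling e_conn adjP kk_le (ltnW n_gt1) L_ge L_min st_ge st_min en2 cov2 v72 sw.
apply: hoare_weaken H (leqnn _) _.
move=> s3 w3 bs3 _ [-> en3 cov3].
exact: (hoare_rounds e_sym e_conn adjP kk_le n_gt1 (erefl _) e_helly hits).
Qed.

End Run.

(** * Counting coin sequences *)

(** Lists rather than tuples, so that [take] and [drop] split off coins without casts;
    [card_tuple_nb] returns to tuples. *)
Fixpoint bitseqs (T : nat) : seq (seq bool) :=
  if T is T'.+1 then map (cons true) (bitseqs T') ++ map (cons false) (bitseqs T')
  else [:: [::]].

Lemma mem_bitseqs T w : (w \in bitseqs T) = (size w == T).
Proof.
elim: T w => [|T IH] w; first by case: w.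
rewrite /= mem_cat; case: w => [|b w].
  by apply/negbTE/norP; split; apply/negP => /mapP[].
by case: b; rewrite mem_map ?IH /= ?eqSS; try (by move=> ? ? []);
  rewrite ?orbF //; case: mapP => [[w' _ []]|_]; rewrite ?orbF //=.
Qed.

Lemma bitseqs_uniq T : uniq (bitseqs T).
Proof.
elim: T => //= T IH; rewrite cat_uniq !map_inj_uniq ?IH //; try by move=> ? ? [].
by rewrite andbT; apply/hasPn => w /mapP[w' _ ->]; apply/negP => /mapP[w'' _].
Qed.

Lemma size_bitseqs T : size (bitseqs T) = 2 ^ T.
Proof. by elim: T => //= T IH; rewrite size_cat !size_map IH expnS; lia. Qed.

Definition nb (T : nat) (P : pred (seq bool)) : nat := count P (bitseqs T).

Lemma nbS T P : nb T.+1 P = nb T (fun w => P (true :: w)) + nb T (fun w => P (false :: w)).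
Proof. by rewrite /nb /= count_cat !count_map. Qed.

Lemma eq_nb T P Q : (forall w, size w = T -> P w = Q w) -> nb T P = nb T Q.
Proof. by move=> PQ; apply: eq_in_count => w; rewrite mem_bitseqs => /eqP/PQ. Qed.

(** Independence of the first [a] coins from the remaining [b], in terms of counts. *)
Lemma nb_cat a b P Q : nb (a + b) (fun w => P (take a w) && Q (drop a w)) = nb a P * nb b Q.
Proof.
elim: a P => [|a IH] P.
  rewrite [nb 0 P]/nb /= addn0 add0n.
  rewrite (@eq_nb _ _ (fun w => P [::] && Q w)); last by move=> w _; rewrite take0 drop0.
  by case: (P [::]); rewrite ?mul1n ?mul0n // /nb count_pred0.
by rewrite addSn !nbS /= (IH (fun w => P (true :: w))) (IH (fun w => P (false :: w))) mulnDl.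
Qed.

Lemma nb_take a T P : a <= T -> nb T (fun w => P (take a w)) = nb a P * 2 ^ (T - a).
Proof.
move=> le; rewrite -{1}(subnKC le) -(size_bitseqs (T - a)) -(count_predT (bitseqs _)).
by rewrite -nb_cat; apply: eq_nb => w _; rewrite andbT.
Qed.

(** Appending [L] coins to [a] runs exactly once through the [2 ^ L] numbers from [a * 2 ^ L] on; a
    general [a] is what the induction needs. *)
Lemma nb_bits_val L a (P : pred nat) :
  nb L (fun w => P (bits_val a w)) = \sum_(0 <= x < 2 ^ L) P (a * 2 ^ L + x).
Proof.
elim: L a => [|L IH] a; first by rewrite expn0 big_nat1 muln1 addn0 /nb /= addn0.
rewrite nbS (IH (2 * a + 1)) (IH (2 * a + 0)).
have -> : 2 ^ L.+1 = 2 ^ L + 2 ^ L by rewrite expnS; lia.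
rewrite [RHS](big_cat_nat (n := 2 ^ L)) ?leq_addr //= addnC.
have shift (G : nat -> nat) :
    \sum_(2 ^ L <= i < 2 ^ L + 2 ^ L) G i = \sum_(0 <= i < 2 ^ L) G (i + 2 ^ L).
  by rewrite -{1}[2 ^ L]add0n big_addn addnK.
rewrite shift; congr (_ + _); apply: eq_bigr => x _.
  by congr (nat_of_bool (P _)); nia.
by congr (nat_of_bool (P _)); nia.
Qed.

Lemma card_tuple_nb T P : #|[set w : T.-tuple bool | P (val w)]| = nb T P.
Proof.
rewrite cardE /nb -size_filter.
rewrite -(size_map val); apply: perm_size; apply: uniq_perm.
- by rewrite (map_inj_uniq val_inj) enum_uniq.
- by rewrite filter_uniq ?bitseqs_uniq.
- move=> w; rewrite mem_filter mem_bitseqs; apply/mapP/andP => [[t]|[Pw sw]].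
    by rewrite mem_enum inE => Pt ->; rewrite size_tuple.
  by exists (Tuple sw); rewrite // mem_enum inE.
Qed.

Lemma nb_predC T P : nb T P + nb T (predC P) = 2 ^ T.
Proof. by rewrite /nb count_predC size_bitseqs. Qed.

(** The union bound, by exchanging the sums over coin sequences and over [i]. *)
Lemma nb_exists T (I : finType) (P : I -> pred (seq bool)) :
  nb T (fun w => [exists i, P i w]) <= \sum_i nb T (P i).
Proof.
rewrite /nb -sum1_count big_mkcond /=.
rewrite (eq_bigr (fun i => \sum_(w <- bitseqs T) (P i w : nat))); last first.
  by move=> i _; rewrite -sum1_count big_mkcond.
rewrite exchange_big /=; apply: leq_sum => w _; case: existsP => // -[i Pi].
by rewrite (bigD1 i) //= Pi.
Qed.

Section Misses.
Variables (n L : nat) (n_gt0 : 0 < n).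
Hypothesis L_ge : n <= 2 ^ L.

Definition misses (F : {set 'I_n}) (j : nat) (w : seq bool) : bool :=
  all (fun u => u \notin F) (drawn L n_gt0 j w).

(** Every vertex [v < n <= 2 ^ L] arises at least from the coins that spell [v], so reducing modulo
    [n] leaves at least [#|F|] sequences that hit [F]. *)
Lemma nb_miss1 (F : {set 'I_n}) :
  nb L (fun w => vertex_of_bits n_gt0 w \notin F) <= 2 ^ L - #|F|.
Proof.
pose P x := Ordinal (ltn_pmod x n_gt0) \in F.
have split2 := nb_predC L (fun w => P (bits_val 0 w)); rewrite nb_bits_val in split2.
suff leF : #|F| <= \sum_(0 <= x < 2 ^ L) P (0 * 2 ^ L + x).
  change (nb L (predC (fun w => P (bits_val 0 w))) <= 2 ^ L - #|F|).
  rewrite -split2; move: (nb _ _) (\sum_(_ <= _ < _) _) (#|F|) leF => a b c; lia.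
rewrite (big_cat_nat (n := n)) //=; apply: leq_trans (leq_addr _ _).
rewrite big_mkord -sum1_card big_mkcond /=; apply: leq_sum => v _.
have -> : P (0 * 2 ^ L + v) = (v \in F); last by case: ifP.
by congr (_ \in F); apply: val_inj; rewrite /= mul0n add0n modn_small.
Qed.

Lemma drawn_take j m w : j * L <= m -> drawn L n_gt0 j (take m w) = drawn L n_gt0 j w.
Proof.
elim: j => //= j IH; rewrite mulSn => le; rewrite IH; last by lia.
by rewrite !take_drop take_takel.
Qed.

(** Different samples read disjoint blocks of [L] coins, so the bounds for one sample multiply. *)
Lemma nb_misses (F : {set 'I_n}) j :
  nb (j * L) (misses F j) <= (2 ^ L - #|F|) ^ j.
Proof.
elim: j => [|j IH]; first by rewrite /nb /= /misses.
rewrite mulSnr expnSr.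
rewrite (@eq_nb _ _ (fun w => misses F j (take (j * L) w)
   && (vertex_of_bits n_gt0 (drop (j * L) w) \notin F))); last first.
  move=> w sw; rewrite /misses /= drawn_take // andbC; congr (_ && (vertex_of_bits _ _ \notin F)).
  by rewrite take_oversize // size_drop sw addKn.
by rewrite (nb_cat _ _ _ (fun w => vertex_of_bits n_gt0 w \notin F)) leq_mul ?nb_miss1.
Qed.

Lemma nb_misses_some (I : finType) (F : I -> {set 'I_n}) q j T : j * L <= T ->
  nb T (fun w => [exists i, (q < #|F i|) && misses (F i) j w])
    <= #|I| * ((2 ^ L - q.+1) ^ j * 2 ^ (T - j * L)).
Proof.
move=> le; apply: leq_trans (nb_exists _ _) _; rewrite -sum_nat_const.
apply: leq_sum => i _; case: ltnP => [lt|_] /=; last by rewrite /nb count_pred0.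
rewrite (@eq_nb _ _ (fun w => misses (F i) j (take (j * L) w))); last first.
  by move=> w _; rewrite /misses drawn_take.
rewrite nb_take // leq_mul2r; apply/orP; right; apply: leq_trans (nb_misses _ _) _.
by case: j {le} => // j; rewrite leq_exp2r // leq_sub2l.
Qed.

End Misses.

(** * Bounds *)

Section Sizes.
Variables (n : nat) (e : rel 'I_n) (adj : 'I_n -> seq 'I_n).
Hypotheses (e_simple : simple_graph e) (e_conn : connected_graph e).
Hypothesis adjP : adjacency_lists e adj.

Lemma offset_total : offset adj n = \sum_(u < n) size (adj u).
Proof. by apply: eq_bigl => u; rewrite ltn_ord. Qed.

Lemma size_adj u : size (adj u) = #|[set v | e u v]|.
Proof.
have [uq mem_adj] := adjP u; rewrite -(card_uniqP uq); apply: eq_card => v.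
by rewrite inE mem_adj.
Qed.

(** Sending an ordered adjacent pair to its edge together with its orientation is injective, as
    there are no loops. *)
Lemma offset_le_edges : offset adj n <= 2 * #|edges e|.
Proof.
have [e_sym e_irr] := e_simple.
pose A := [set p : 'I_n * 'I_n | e p.1 p.2].
have -> : offset adj n = #|A|.
  rewrite offset_total -sum1_card (eq_bigl (fun p : 'I_n * 'I_n => e p.1 p.2)); last first.
    by move=> p; rewrite inE.
  rewrite -(pair_big_dep xpredT e (fun _ _ => 1)) /=; apply: eq_bigr => u _.
  by rewrite size_adj -sum1_card; apply: eq_bigl => v; rewrite inE.
pose f (p : 'I_n * 'I_n) := ([set p.1; p.2], p.1 < p.2).
have inj : {in A &, injective f}.
  move=> [u v] [u' v']; rewrite !inE /= => euv euv' [eqs eqb].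
  have nv : u != v by apply/negP => /eqP uv; rewrite uv e_irr in euv.
  have nv' : u' != v' by apply/negP => /eqP uv; rewrite uv e_irr in euv'.
  have := set21 u' v'; rewrite -eqs !inE => /orP[/eqP u'u|/eqP u'v].
    subst u'; have := set22 u v'; rewrite -eqs !inE => /orP[/eqP v'u|/eqP ->] //.
    by rewrite v'u eqxx in nv'.
  subst u'; have := set22 v v'; rewrite -eqs !inE => /orP[/eqP v'u|/eqP v'v]; last first.
    by rewrite v'v eqxx in nv'.
  by subst v'; move: nv eqb; rewrite -(inj_eq val_inj) /=; lia.
rewrite -(card_in_imset inj) mulnC -card_bool -cardsT -cardsX; apply: subset_leq_card.
apply/subsetP => x /imsetP[[u v]]; rewrite inE /= => euv ->.
rewrite !inE andbT; apply/existsP; exists u; apply/existsP; exists v.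
by rewrite euv eqxx.
Qed.

(** By connectivity every vertex has a neighbour. This lets terms linear in [n] be absorbed by the
    number of edges. *)
Lemma leq_offset : 1 < n -> n <= offset adj n.
Proof.
move=> n_gt1; rewrite offset_total -[X in X <= _]card_ord -sum1_card.
apply: leq_sum => u _; rewrite size_adj card_gt0; apply/set0Pn.
have [v uv] : exists v, u != v.
  pose a := Ordinal (ltnW n_gt1); pose b := Ordinal n_gt1.
  by have [->|] := eqVneq u a; [exists b | exists a].
have /connectP[p pp lp] := e_conn u v.
case: p pp lp => [|w p] /=; first by move=> _ vu; rewrite vu eqxx in uv.
by case/andP=> euw _ _; exists w; rewrite inE.
Qed.

Lemma offset_le_sq : offset adj n <= n * n.
Proof.
rewrite offset_total; have -> : n * n = \sum_(u < n) n by rewrite sum_nat_const card_ord.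
apply: leq_sum => u _.
by rewrite size_adj -[X in _ <= X]card_ord max_card.
Qed.

End Sizes.

(** Searches take time linear in the number of edges. [st * L.+1] accounts for the samples with
    their tosses and searches, [minn k n * q.+1] for the searches of the rounds; the successors
    absorb what is spent per sample or per round. *)
Lemma total_time_le : exists c : nat, forall n k (e : rel 'I_n) adj L st q,
  1 < n -> simple_graph e -> connected_graph e -> adjacency_lists e adj -> 0 < st ->
  total_time k adj L st q <= 2 * bit_length k
    + c * #|edges e| * (st * L.+1 + minn k n * q.+1) * bit_length (max_value adj).
Proof.
pose c1 := cmd_weight bfs + 100.
pose c2 := c1 + (17 + cmd_weight merge_body).
pose c3 := cmd_weight argmin_start + (16 + cmd_weight argmin_body).
pose c4 := 42 + c1 + cmd_weight copy_body + cmd_weight far_body + c2 + c3.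
pose c5 := 42 + cmd_weight toss_body + c2.
exists (5 * (10 + cmd_weight setup + 12 + c5 + c3 + 13 + 4 + c4)).
move=> n k e adj L st q n1 es ec ea st0.
rewrite /total_time leq_add2l leq_mul2r; apply/orP; right.
have le1 := offset_le_edges es ea; have le2 := leq_offset ec ea n1.
set m := #|edges e| in le1 *; set kk := minn k n.
have bfsE : bfs_time adj = c1 * (n + offset adj n + 1) by [].
have c2E : c2 = c1 + (17 + cmd_weight merge_body) by [].
have c3E : c3 = cmd_weight argmin_start + (16 + cmd_weight argmin_body) by [].
have c4E : c4 = 42 + c1 + cmd_weight copy_body + cmd_weight far_body + c2 + c3 by [].
have c5E : c5 = 42 + cmd_weight toss_body + c2 by [].
clearbody c5 c4 c3 c2 c1.
(* 5 = 2 + 2 + 1, from [n <= offset adj n <= 2 * m] and [1 <= m]. *)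
have D5 : n + offset adj n + 1 <= 5 * m by lia.
have nD : n.+1 <= n + offset adj n + 1 by lia.
move: (n + offset adj n + 1) bfsE D5 nD => D bfsE D5 nD.
have D_gt0 : 0 < D by lia.
have addE : add_time adj <= c2 * D.
  by rewrite /add_time bfsE c2E; move: (cmd_weight merge_body) => a; nia.
have argE : argmin_time n <= c3 * D.
  by rewrite /argmin_time c3E; move: (cmd_weight argmin_start) (cmd_weight argmin_body) => a b; nia.
have roundE : round_time adj q <= D * (q.+1 * c4).
  rewrite /round_time bfsE c4E.
  have : q * add_time adj <= q * (c2 * D) by rewrite leq_mul2l addE orbT.
  move: (q * add_time adj) (argmin_time n) argE => x y argE.
  move: (cmd_weight copy_body) (cmd_weight far_body) => a b lex.
  have nab : 22 + n * (a + 10) + n * (b + 10) <= D * (42 + a + b) by nia.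
  have -> : D * (q.+1 * (42 + c1 + a + b + c2 + c3)) =
    D * (42 + a + b) + D * c1 + D * c2 + D * c3 + q * (c2 * D)
    + q * (D * (42 + c1 + a + b + c3)) by nia.
  have cD1 := mulnC D c1; have cD2 := mulnC D c2; have cD3 := mulnC D c3; lia.
have sampE : sampling_time adj L st <= D * (12 + st * L.+1 * c5).
  have le18 : 18 + sample_time L + add_time adj <= D * (L.+1 * c5).
    rewrite /sample_time c5E; move: (add_time adj) (cmd_weight toss_body) addE => x a addE.
    have -> : D * (L.+1 * (42 + a + c2)) =
      D * 42 + D * a + c2 * D + D * (L * (42 + a + c2)) by nia.
    have : L * (a + 4) <= D * (L * (42 + a + c2)) by nia.
    by nia.
  rewrite /sampling_time [D * _]mulnDr leq_add //; first by lia.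
  by rewrite -mulnA mulnCA leq_mul2l le18 orbT.
have rE : rounds_time kk adj q <= D * (c3 + 13 + kk * q.+1 * (4 + c4)).
  have le4 : 4 + round_time adj q <= D * (q.+1 * (4 + c4)).
    by rewrite 2!mulnDr leq_add // mulnA leq_pmull // muln_gt0 D_gt0.
  rewrite /rounds_time [D * _]mulnDr leq_add //.
    by rewrite mulnDr leq_add // 1?mulnC //; apply: leq_pmulr.
  by rewrite -mulnA mulnCA leq_mul2l le4 orbT.
have X0 : 0 < st * L.+1 by rewrite muln_gt0 st0.
move: (sampling_time _ _ _) (rounds_time _ _ _) sampE rE => x y.
move: (st * L.+1) X0 (kk * q.+1) (cmd_weight setup) => X X0 Y a sampE rE.
apply: (@leq_trans (D * (10 + a + 12 + c5 + c3 + 13 + 4 + c4) * (X + Y))); last first.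
  by rewrite leq_mul2r; apply/orP; right; rewrite mulnAC leq_mul2r D5 orbT.
have h1 : 10 + a <= D * ((10 + a) * X) by rewrite mulnCA leq_pmulr // muln_gt0 D_gt0.
have h2 : 12 + X * c5 <= (12 + c5) * X.
  by rewrite mulnDl leq_add // 1?mulnC //; apply: leq_pmull.
have h3 : c3 + 13 + Y * (4 + c4) <= (c3 + 13) * X + (4 + c4) * Y.
  by rewrite leq_add // 1?mulnC //; apply: leq_pmull.
have {}h2 := leq_trans sampE (leq_mul (leqnn D) h2).
have {}h3 := leq_trans rE (leq_mul (leqnn D) h3).
apply: (@leq_trans (D * ((10 + a) * X + (12 + c5) * X + ((c3 + 13) * X + (4 + c4) * Y)))).
  by rewrite 2![D * _]mulnDr; lia.
rewrite -mulnA leq_mul2l; apply/orP; right.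
rewrite !mulnDr !mulnDl; lia.
Qed.

(** The value is at most n^2 + 6n + 8 <= 8 n^2, and 8 <= n^3 since n >= 2. *)
Lemma max_value_le n (e : rel 'I_n) adj : 1 < n -> adjacency_lists e adj ->
  max_value adj <= n ^ 5.
Proof.
move=> n1 ea; have := offset_le_sq ea; rewrite /max_value /work => le.
have -> : n ^ 5 = (n * n * n) * (n * n) by rewrite !expnS expn0; lia.
have : 8 * (n * n) <= (n * n * n) * (n * n) by rewrite leq_mul2r; nia.
by nia.
Qed.

(** Bounds the cost of reading [k], which may be huge compared with [n], by a multiple of sqrt(k),
    so that it fits into sqrt(kn). *)
Lemma sqr_bit_length_le k : 0 < k -> bit_length k * bit_length k <= 4 * k.
Proof.
move=> k0; rewrite /bit_length; have := trunc_logP (isT : 1 < 2) k0.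
move: (trunc_log 2 k) => t le; apply: (@leq_trans (4 * 2 ^ t)); last by lia.
elim: t {k k0 le} => // -[|[|t]] // IH.
by rewrite expnS; move: (2 ^ t.+2) IH => x; nia.
Qed.

(** * Estimates with real logarithms and square roots *)

Section Bounds.
Local Open Scope ring_scope.
Variable R : realType.

Lemma ln2_ge : 1 / 2 <= ln 2 :> R.
Proof.
have le : 2^-1 <= sequences.expR (- (1 / 2)) :> R.
  by have := expR_ge1Dx (- (1 / 2) : R); lra.
have : ln 2^-1 <= ln (sequences.expR (- (1 / 2))) :> R.
  by rewrite ler_ln // posrE ?expR_gt0 ?invr_gt0.
by rewrite expRK lnV ?posrE //; lra.
Qed.

Lemma exp2_le_ln (n t : nat) : (0 < n)%N -> (2 ^ t <= n)%N -> t%:R <= 2 * ln n%:R :> R.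
Proof.
move=> n0 le.
have : ln (2 ^+ t) <= ln n%:R :> R.
  by rewrite ler_ln ?posrE ?exprn_gt0 ?ltr0n // -natrX ler_nat.
rewrite lnXn // -[ln 2 *+ t]mulr_natl => le'.
by have := ler_wpM2l (ler0n R t) ln2_ge; lra.
Qed.

Lemma ln_nat_ge (n : nat) : (1 < n)%N -> 1 / 2 <= ln n%:R :> R.
Proof.
move=> n1; apply: le_trans ln2_ge _; rewrite ler_ln ?posrE ?ltr0n ?ler_nat //.
exact: ltnW.
Qed.

Lemma bit_length_le_ln (n : nat) : (1 < n)%N -> (bit_length n)%:R <= 4 * ln n%:R :> R.
Proof.
move=> n1; have n0 := ltnW n1.
have := exp2_le_ln n0 (trunc_logP (isT : 1 < 2)%N n0).
by have := ln_nat_ge n1; rewrite /bit_length -[(trunc_log 2 n).+1%:R]natr1; lra.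
Qed.


(** In the notation [rt], [l] of the proof, 26 is 12 for [st * L.+1], 12 for [kk * q] and 2 for
    [kk], each in units of [rt * l]; [B <= 20 * l] gives 520 = 26 * 20. The 16 pays for reading [k],
    using [l >= 1/2]. *)
Lemma time_bound (c n k L st q m B : nat) :
  (1 < n)%N -> (0 < k)%N -> (0 < m)%N -> (0 < st)%N ->
  (forall j, (j < L)%N -> (2 ^ j < n)%N) ->
  (minn k n * n <= st * st)%N -> (forall j, (j < st)%N -> (j * j < minn k n * n)%N) ->
  q%:R <= 6 * n%:R * ln n%:R / st%:R :> R -> (B <= 5 * bit_length n)%N ->
  (2 * bit_length k + c * m * (st * L.+1 + minn k n * q.+1) * B)%:R
    <= (16 + 520 * c%:R) * m%:R * Num.sqrt (k * n)%:R * ln n%:R ^+ 2 :> R.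
Proof.
move=> n1 k0 m0 st0 Lmin stge stmin qle Ble.
set kk := minn k n in stge stmin *; set l := ln n%:R in qle *.
set rt := Num.sqrt _.
have l2 : 1 / 2 <= l by apply: ln_nat_ge.
have rt0 : 0 <= rt by apply: sqrtr_ge0.
have rt2 : rt ^+ 2 = (k * n)%:R by rewrite sqr_sqrtr.
have le_rt (x : R) : 0 <= x -> x ^+ 2 <= rt ^+ 2 -> x <= rt.
  by move=> x0; rewrite ler_sqr ?nnegrE.
have kkn : (kk * n)%:R <= rt ^+ 2 by rewrite rt2 ler_nat leq_mul2r geq_minl orbT.
have rt1 : 1 <= rt by apply: le_rt => //; rewrite expr1n rt2 ler1n muln_gt0 k0 ltnW.
have stle : st%:R <= 2 * rt.
  have : (st.-1)%:R <= rt.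
    apply: le_rt => //; apply: le_trans kkn; rewrite -natrX ler_nat expnS expn1.
    by apply/ltnW/stmin; rewrite prednK.
  by rewrite -[in X in _ -> X](prednK st0) -[(st.-1.+1)%:R]natr1; lra.
have kkle : kk%:R <= rt.
  apply: le_rt => //; apply: le_trans kkn; rewrite -natrX ler_nat expnS expn1.
  by rewrite leq_mul2l geq_minr orbT.
have Lle : L.+1%:R <= 6 * l.
  case: L Lmin => [|L] Lmin; first by lra.
  have := exp2_le_ln (ltnW n1) (ltnW (Lmin L (leqnn _))); rewrite -/l.
  by rewrite -[L.+2%:R]natr1 -[L.+1%:R]natr1; lra.
(* The choice of [st] gives [kk * n / st <= st]: here the searches of the rounds balance those of
   the sampling. *)
have kqle : kk%:R * q%:R <= 12 * rt * l.
  have st0' : 0 < st%:R :> R by rewrite ltr0n.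
  apply: (@le_trans _ _ (kk%:R * (6 * n%:R * l / st%:R))); first by rewrite ler_wpM2l.
  have -> : kk%:R * (6 * n%:R * l / st%:R) = 6 * l * ((kk * n)%:R / st%:R).
    by rewrite natrM; ring.
  have : (kk * n)%:R / st%:R <= 2 * rt.
    by apply: le_trans stle; rewrite ler_pdivrMr // -natrM ler_nat.
  by move: (_ / _) => x; nra.
have Xle : (st * L.+1 + kk * q.+1)%:R <= 26 * rt * l.
  rewrite natrD !natrM -[q.+1%:R]natr1 mulrDr mulr1.
  have : st%:R * L.+1%:R <= (2 * rt) * (6 * l) by apply: ler_pM.
  by move: kqle kkle; move: (_ * _) (_ * L.+1%:R) => x y; nra.
have Bl : B%:R <= 20 * l.
  have := bit_length_le_ln n1; rewrite -/l => bl.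
  have : B%:R <= (5 * bit_length n)%:R :> R by rewrite ler_nat.
  by rewrite natrM; lra.
have kle : (bit_length k)%:R <= 2 * rt.
  have : (bit_length k)%:R / 2 <= rt; last by lra.
  apply: le_rt => //; first by rewrite divr_ge0.
  rewrite rt2 expr_div_n ler_pdivrMr ?exprn_gt0 // -!natrX -natrM ler_nat.
  have := sqr_bit_length_le k0; rewrite expnS expn1; nia.
rewrite natrD natrM [(c * m * _ * _)%:R]natrM [(c * m * _)%:R]natrM [(c * m)%:R]natrM.
have m1 : 1 <= m%:R :> R by rewrite ler1n.
have h1 : 2%:R * (bit_length k)%:R <= 16 * m%:R * rt * l ^+ 2.
  apply: (@le_trans _ _ (4 * rt)); first by lra.
  have : 1 / 4 <= l ^+ 2 by nra.
  move: (l ^+ 2) => y y4; have : 1 / 4 <= m%:R * y by nra.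
  have -> : 16 * m%:R * rt * y = 16 * rt * (m%:R * y) by ring.
  by move: (m%:R * y) => z; nra.
have h2 : c%:R * m%:R * (st * L.+1 + kk * q.+1)%:R * B%:R
    <= c%:R * m%:R * ((26 * rt * l) * (20 * l)).
  by rewrite -mulrA; apply: ler_wpM2l; [rewrite mulr_ge0|apply: ler_pM].
apply: le_trans (lerD h1 h2) _.
by rewrite le_eqVlt; apply/orP; left; apply/eqP; ring.
Qed.

(** By [1 + x <= exp x], all [st] samples miss one set with probability at most exp(-st (q+1) /
    2^L), which is at most n^(-3) because 2^L <= 2n and st (q+1) > 6 n ln n; there are n^2 sets. *)
Lemma miss_bound (n L st q T : nat) :
  (1 < n)%N -> (0 < st)%N -> (n <= 2 ^ L)%N -> (2 ^ L <= 2 * n)%N -> (st * L <= T)%N ->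
  6 * n%:R * ln n%:R / st%:R < q.+1%:R :> R ->
  (n * n * ((2 ^ L - q.+1) ^ st * 2 ^ (T - st * L)))%:R / (2 ^ T)%:R <= 1 / n%:R :> R.
Proof.
move=> n1 st0 Lge Lle NT qgt.
have n0 : 0 < n%:R :> R by rewrite ltr0n ltnW.
have p0 : 0 < (2 ^ L)%:R :> R by rewrite ltr0n expn_gt0.
have s0 : 0 < st%:R :> R by rewrite ltr0n.
have -> : (2 ^ T)%:R = (2 ^ L)%:R ^+ st * (2 ^ (T - st * L))%:R :> R.
  by rewrite -natrX -natrM -expnM -expnD mulnC subnKC.
set l := ln n%:R in qgt *; set P := (2 ^ L)%:R : R.
rewrite !natrM natrX; set a := (2 ^ L - q.+1)%:R : R.
have b0 : (2 ^ (T - st * L))%:R != 0 :> R by rewrite pnatr_eq0 -lt0n expn_gt0.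
have -> : n%:R * n%:R * (a ^+ st * (2 ^ (T - st * L))%:R) / (P ^+ st * (2 ^ (T - st * L))%:R)
    = n%:R * n%:R * (a / P) ^+ st.
  rewrite expr_div_n; have : P ^+ st != 0 by rewrite expf_neq0 // gt_eqF.
  by move: (P ^+ st) (a ^+ st) (_%:R) b0 => y x b b0 y0; field; rewrite y0 b0.
have le_exp : a / P <= sequences.expR (- (q.+1%:R / P)).
  (* If [q.+1] exceeds [2 ^ L], the truncated subtraction makes the left side 0. *)
  have [le|gt] := leqP q.+1 (2 ^ L); last first.
    have -> : a = 0 by rewrite /a (eqP (ltnW gt : (2 ^ L - q.+1 == 0)%N)).
    by rewrite mul0r expR_ge0.
  have -> : a / P = 1 - q.+1%:R / P.
    by rewrite /a natrB // mulrBl divff // gt_eqF.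
  exact: expR_ge1Dx.
have le_pow : (a / P) ^+ st <= sequences.expR (- l) ^+ 3.
  apply: (@le_trans _ _ (sequences.expR (- (q.+1%:R / P)) ^+ st)).
    by apply: lerXn2r; rewrite ?nnegrE ?expR_ge0 // divr_ge0 // ltW.
  rewrite -!expRM_natl ler_expR mulrN mulrN lerN2.
  have P2 : P <= 2 * n%:R by rewrite -natrM ler_nat.
  have : 6 * n%:R * l < q.+1%:R * st%:R by rewrite -ltr_pdivrMr.
  rewrite mulrA ler_pdivlMr //.
  have l0 : 0 <= l by have := ln_nat_ge n1; rewrite -/l; lra.
  move=> lt; apply: (@le_trans _ _ (6 * n%:R * l)); last by rewrite [st%:R * _]mulrC ltW.
  have : l * P <= l * (2 * n%:R) by apply: ler_wpM2l.
  by lra.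
apply: (@le_trans _ _ (n%:R * n%:R * sequences.expR (- l) ^+ 3)).
  by apply: ler_wpM2l => //; rewrite mulr_ge0 // ltW.
rewrite expRN lnK ?posrE // le_eqVlt; apply/orP; left; apply/eqP.
by field; rewrite gt_eqF.
Qed.

End Bounds.

Lemma least_witness (P : pred nat) : (exists j, P j) ->
  exists2 i, P i & forall j, j < i -> ~~ P j.
Proof.
move=> ex; case: (ex_minnP ex) => i Pi mi; exists i => // j ji.
by apply/negP => /mi; rewrite leqNgt ji.
Qed.

(** * Success probability *)

Section Success.
Local Open Scope ring_scope.

(** The far sets of a run depend on the coins, the sets [F p] do not, so the union bound is taken
    over all pairs [p]; outside the event [bad] the deterministic analysis applies. *)
Lemma success_prob_ge (R : realType) (n k alpha L st q T : nat) (e : rel 'I_n)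
    (adj : 'I_n -> seq 'I_n) :
  (1 < n)%N -> symmetric e -> connected_graph e -> helly e k alpha ->
  adjacency_lists e adj ->
  (n <= 2 ^ L)%N -> (forall j, (j < L)%N -> (2 ^ j < n)%N) ->
  (minn k n * n <= st * st)%N -> (forall j, (j < st)%N -> (j * j < minn k n * n)%N) ->
  (total_time k adj L st q <= T)%N -> (st * L <= T)%N ->
  1 - (n * n * ((2 ^ L - q.+1) ^ st * 2 ^ (T - st * L)))%:R / (2 ^ T)%:R
    <= success_prob R T radius_cmd (graph_input adj k)
         (fun r => (r <= radius e)%N /\ (radius e <= r + alpha)%N).
Proof.
move=> n1 esym ec eh ea Lge Lmin stge stmin total NT.
have n0 : (0 < n)%N := ltnW n1.
pose F (p : 'I_n * 'I_n) := [set v | p.2 <= dist e p.1 v]%N.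
pose bad w := [exists p, (q < #|F p|)%N && misses L n0 (F p) st w].
have nbad := nb_misses_some n0 Lge F q NT.
rewrite card_prod card_ord -/(nb T bad) in nbad.
rewrite /success_prob; set A := [set w : T.-tuple bool | _].
have sub : [set w : T.-tuple bool | predC bad (val w)] \subset A.
  apply/subsetP => w; rewrite !inE => good; apply/asboolP.
  have [] := @exec_radius_cmd n k alpha e adj n1 esym ec ea eh L st q Lge Lmin stge stmin w.
  - by rewrite size_tuple.
  - move=> x t big.
    have /existsP[v xv] : [exists v, (t <= dist e x v)%N].
      apply: contraLR big; rewrite negb_exists -leqNgt => /forallP none.
      by rewrite (_ : [set _ | _] = set0) ?cards0 //; apply/setP => v; rewrite !inE (negbTE (none v)).
    (* Thresholds [t >= n] give empty sets, so [n * n] pairs suffice. *)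
    have tn : (t < n)%N.
      by apply: leq_ltn_trans xv _; have := dist_lt_card ec x v; rewrite card_ord.
    have : ~~ misses L n0 (F (x, Ordinal tn)) st w.
      by move: good => /existsPn/(_ (x, Ordinal tn)); rewrite big.
    rewrite /misses -has_predC => /hasP[u uD]; rewrite /= negbK inE /= => le.
    by exists u => //; rewrite (bool_irrelevance (ltnW n1) n0).
  - move=> s' [w' [t [ex tle Qs]]]; exists s', w', t; split=> //.
    exact: leq_trans tle total.
have cardA : (2 ^ T <= #|A| + n * n * ((2 ^ L - q.+1) ^ st * 2 ^ (T - st * L)))%N.
  rewrite -(nb_predC T bad) addnC leq_add //.
  by rewrite -card_tuple_nb subset_leq_card.
have p0 : 0 < (2 ^ T)%:R :> R by rewrite ltr0n expn_gt0.
rewrite lerBlDr -mulrDl ler_pdivlMr // mul1r -natrD ler_nat.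
exact: cardA.
Qed.

End Success.

Local Open Scope ring_scope.

Theorem theorem4 (R : realType) :
  exists (A : cmd) (C : R) (d : nat) (c : R),
    0 < c /\
    forall (k alpha n : nat) (e : rel 'I_n) (adj : 'I_n -> seq 'I_n),
      (2 <= k)%N -> (0 < n)%N ->
      simple_graph e -> connected_graph e -> helly e k alpha ->
      adjacency_lists e adj ->
      let m := #|edges e| in
      let T := Num.truncn
        (C * m%:R * Num.sqrt ((k * n)%:R) * ln (n%:R) ^+ d : R) in
      1 - 1 / (n%:R `^ c)
        <= success_prob R T A (graph_input adj k)
             (fun r => (r <= radius e)%N /\ (radius e <= r + alpha)%N).
Proof.
have [c0 total_le] := total_time_le.
exists radius_cmd, (16 + 520 * c0%:R), 2%N, 1; split=> //.
move=> k alpha n e adj k2 n0 es ec eh ea; cbv zeta.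
set m := #|edges e|; set T := Num.truncn _; rewrite powRr1 //.
(* For n = 1 the logarithm makes the time bound 0, but the required probability is 0 as well. *)
have [n1|n1] := leqP n 1.
  have -> : n%:R = 1 :> R by apply/eqP; rewrite pnatr_eq1 eqn_leq n1 n0.
  by rewrite divr1 subrr divr_ge0.
have k0 : (0 < k)%N := ltnW k2.
have [L Lge Lmin] := @least_witness (fun L => n <= 2 ^ L)%N
  (ex_intro _ n (ltnW (ltn_expl n (isT : (1 < 2)%N)))).
have {}Lmin j : (j < L)%N -> (2 ^ j < n)%N by move=> /Lmin; rewrite -ltnNge.
have [st stge stmin] := @least_witness (fun s => minn k n * n <= s * s)%N
  (ex_intro _ n (leq_mul (geq_minr k n) (leqnn n))).
have {}stmin j : (j < st)%N -> (j * j < minn k n * n)%N by move=> /stmin; rewrite -ltnNge.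
have st0 : (0 < st)%N.
  have : (0 < minn k n * n)%N by rewrite muln_gt0 leq_min k0 n0.
  by move: stge; case: (st) => //; lia.
have m0 : (0 < m)%N.
  by have := offset_le_edges es ea; have := leq_offset ec ea n1; rewrite -/m; lia.
set x : R := 6 * n%:R * ln n%:R / st%:R.
have x0 : 0 <= x.
  by rewrite /x divr_ge0 ?mulr_ge0 //; have := @ln_nat_ge R n n1; lra.
have /andP[qle qgt] := truncn_itv x0; set q := Num.truncn x in qle qgt.
have Ble : (bit_length (max_value adj) <= 5 * bit_length n)%N.
  by apply: bit_length_exp => //; apply: max_value_le ea.
have tot := total_le n k e adj L st q n1 es ec ea st0.
have bound := time_bound c0 n1 k0 m0 st0 Lmin stge stmin qle Ble.
have leT : (total_time k adj L st q <= T)%N.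
  apply: leq_trans tot _; rewrite /T truncn_ge_nat //.
  by rewrite !mulr_ge0 ?sqrtr_ge0 ?exprn_ge0 ?addr_ge0 ?mulr_ge0 //;
    have := @ln_nat_ge R n n1; lra.
(* The [T] coins must suffice for all samples; they do because the time bound already counts every
   toss. *)
have NT : (st * L <= T)%N.
  apply: leq_trans leT; apply: (@leq_trans (sampling_time adj L st)).
    by rewrite /sampling_time /sample_time; move: (cmd_weight _) (add_time _); nia.
  rewrite /total_time; have := bit_length_gt0 (max_value adj); nia.
have Lle : (2 ^ L <= 2 * n)%N.
  by case: L Lmin {Lge tot bound leT NT} => [|L] Lmin; [lia | rewrite expnS leq_mul2l ltnW ?Lmin].
apply: le_trans (success_prob_ge R n1 es.1 ec eh ea Lge Lmin stge stmin leT NT).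
by rewrite lerB //; apply: miss_bound.
Qed.
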